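(* Let $h:\Omega\to\mathbb{C}$ be a non-constant holomorphic map in a domain $\Omega\subset\mathbb{C}$ and let $E\subset\Omega$ be a compact set. Then $\dim_A^\theta h(E)\leq \dim_A^\theta E$ for all $\theta\in(0,1)$.
   Context: Here $\dim_A^\theta$ denotes the (regularized) Assouad spectrum, defined as follows. For $z\in\mathbb{C}$ and $R>0$ let $D(z,R)$ be the open disc centered at $z$ of radius $R$. For $E\subset\mathbb{C}$ and $0<r\le R$, let $N(D(z,R)\cap E,r)$ be the smallest number of sets of diameter at most $r$ needed to cover $D(z,R)\cap E$. For $\theta\in(0,1)$, $\dim_A^\theta E$ is the infimum of all $\alpha>0$ for which there exists $C>0$ such that $N(D(z,R)\cap E,r)\le C(R/r)^\alpha$ for all $0<r\le R^{1/\theta}<R<1$ and all $z\in E$. *)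

(* Defs.v *)
From mathcomp Require Import all_boot all_order all_algebra.
From mathcomp Require Import all_classical all_reals all_analysis.
From mathcomp Require Import complex.

Set Implicit Arguments.
Unset Strict Implicit.
Unset Printing Implicit Defensive.

Import Order.TTheory GRing.Theory Num.Theory.
Import numFieldNormedType.Exports.

Local Open Scope classical_set_scope.
Local Open Scope ring_scope.
Local Open Scope complex_scope.

(* The complex plane is [R[i]^o]: the regular module carries the normed and
   topological structure over the field [R[i]].  Its norm is [R[i]]-valued
   (a nonnegative real seen as a complex number), whence [complex.Re] for
   real distances and [rad%:C] for the real radius of a disc. *)

Definition complex_domain (R : realType) (Omega : set R[i]^o) : Prop :=
  [/\ Omega !=set0, open Omega & connected Omega].

(* [derivable h z 1] is complex differentiability: the increment of the
   difference quotient ranges over the scalar field [R[i]]. *)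
Definition holomorphic_on (R : realType) (Omega : set R[i]^o)
    (h : R[i]^o -> R[i]^o) : Prop :=
  forall z, Omega z -> derivable h z 1.

Definition nonconstant_on (R : realType) (Omega : set R[i]^o)
    (h : R[i]^o -> R[i]^o) : Prop :=
  exists z w, [/\ Omega z, Omega w & h z <> h w].

(* The value is [-oo] on the empty set, and [+oo] on unbounded sets. *)
Definition diameter (R : realType) (A : set R[i]^o) : \bar R :=
  ereal_sup [set (complex.Re `|z - w|)%:E | z in A & w in A].

Definition coverable (R : realType) (A : set R[i]^o) (r : R) (n : nat) : Prop :=
  exists U : 'I_n -> set R[i]^o,
    (forall i, (diameter (U i) <= r%:E)%E) /\ A `<=` \bigcup_i U i.

(* The smallest [n] such that [A] is covered by [n] sets of diameter at most
   [r], and [+oo] if no finite cover exists. *)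
Definition covering_number (R : realType) (A : set R[i]^o) (r : R) : \bar R :=
  ereal_inf [set n%:R%:E | n in coverable A r].

Definition assouad_bound (R : realType) (theta : R) (E : set R[i]^o)
    (alpha : R) : Prop :=
  exists2 C : R, 0 < C &
    forall (z : R[i]^o) (rad r : R), E z ->
      0 < r <= rad `^ theta^-1 -> rad `^ theta^-1 < rad < 1 ->
      (covering_number (ball z rad%:C `&` E) r
         <= (C * (rad / r) `^ alpha)%:E)%E.

Definition assouad_spectrum (R : realType) (theta : R) (E : set R[i]^o)
    : \bar R :=
  ereal_inf [set alpha%:E | alpha in
    [set alpha : R | 0 < alpha /\ assouad_bound theta E alpha]].

(* Main.v *)
Require Import Defs.
From mathcomp Require Import all_boot all_order all_algebra finmap.
From mathcomp Require Import all_classical all_reals all_analysis.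
From mathcomp Require Import complex.
From mathcomp Require Import ring lra.

Import Order.TTheory GRing.Theory Num.Theory.
Import numFieldNormedType.Exports.

Local Open Scope classical_set_scope.
Local Open Scope ring_scope.

(** A holomorphic map may distort distances badly near its critical points, yet
    it cannot raise the Assouad spectrum, and in fact every exponent admissible
    for [E] is admissible for [h @` E].

    Near a point [z0] write [h z - h z0 = (z - z0) ^+ m * g z] with [m >= 1] and
    [g z0 != 0].  Consider the part of [E] near [z0] that [h] maps into a disc of
    radius [rad].  If the disc is far from [h z0] compared with [rad], this part
    splits into boundedly many pieces on which [h] expands distances by
    about [u ^ (m - 1)], where [u] is the distance to [z0], and which therefore
    have diameter [rho] of the order of [rad / u ^ (m - 1)]; [h] is Lipschitz on
    them with a constant [l] of the order of [u ^ (m - 1)].  If the disc is close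
    to [h z0], there is a single piece, with [rho] of the order of
    [rad ^ (1 / m)] and [l] of the order of [rho ^ (m - 1)].  In both cases
    [l * rho] is at most a constant times [rad], so that covering the piece at
    scale [r / l] inside a disc of radius [rho] involves the ratio
    [rho / (r / l)], comparable to [rad / r].  In both cases moreover [rho] is at
    least a constant times [rad]; as [theta < 1], the condition
    [r <= rad `^ theta^-1] is then inherited by [r / l] and [rho] up to a
    constant ([covers_lipschitz_piece]).  The decomposition is [local_cover]; a
    finite subcover of [E] concludes ([assouad_bound_image]).

    The factorization is derived from complex differentiability alone.
    Goursat's theorem on rectangles, extended to functions that are merely
    continuous at one point, applies to the difference quotients of [h] and gives
    Cauchy's formula on a square, in the form: [h] times the transform of [1] is
    the Cauchy transform of [h].  Cauchy transforms are stable under divided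
    differences, so that either all iterated divided differences vanish at [z0]
    and [h] is locally constant, or the first nonvanishing one yields [m] and [g]
    ([local_factorization]).  The first alternative is excluded by the identity
    theorem, as [h] is not constant on the connected set [Omega]
    ([nowhere_locally_constant]). *)

Set Implicit Arguments.
Unset Strict Implicit.
Unset Printing Implicit Defensive.
Local Open Scope complex_scope.
Import Normc.

(** * The modulus and the topology of the complex plane *)

Section ComplexNorm.
Context {R : realType}.
Implicit Types (x y z w : R[i]).

Lemma normc_ge0 z : 0 <= normc z.
Proof. by case: z => a b /=; rewrite sqrtr_ge0. Qed.

Lemma normcX z n : normc (z ^+ n) = normc z ^+ n.
Proof. by elim: n => [|n IH]; rewrite ?expr0 ?normc1// !exprS normcM IH. Qed.

Lemma normc_real (a : R) : normc a%:C = `|a|.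
Proof. by rewrite /normc /= expr0n /= addr0 sqrtr_sqr. Qed.

Lemma normcB z w : normc (z - w) = normc (w - z).
Proof. by rewrite -normcN opprB. Qed.

Lemma ler_normcB z w : normc (z - w) <= normc z + normc w.
Proof. by rewrite -[normc w]normcN; exact: le_normcD. Qed.

Lemma ler_normc_dist z w : normc z - normc w <= normc (z - w).
Proof. by rewrite lerBlDr -{1}[z](subrK w); exact: le_normcD. Qed.

Lemma normc_gt0 z : (0 < normc z) = (z != 0).
Proof.
rewrite lt_def normc_ge0 andbT; congr negb; apply/eqP/eqP => [/eq0_normc//|->].
by rewrite normc0.
Qed.

Lemma normc_eq0 z : (normc z == 0) = (z == 0).
Proof. by rewrite -[LHS]negbK -[RHS]negbK -normc_gt0 lt_def normc_ge0 andbT. Qed.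

Lemma normc_le0 z : normc z <= 0 -> z = 0.
Proof. by move=> z0; apply: eq0_normc; apply/eqP; rewrite eq_le z0 normc_ge0. Qed.

Lemma normRe z : `|complex.Re z| <= normc z.
Proof.
case: z => a b /=; rewrite -[leLHS]sqrtr_sqr ler_sqrt ?lerDl ?sqr_ge0//.
by rewrite addr_ge0 ?sqr_ge0.
Qed.

Lemma normIm z : `|complex.Im z| <= normc z.
Proof.
case: z => a b /=; rewrite -[leLHS]sqrtr_sqr ler_sqrt ?lerDr ?sqr_ge0//.
by rewrite addr_ge0 ?sqr_ge0.
Qed.

Lemma normc_ReIm z : normc z <= `|complex.Re z| + `|complex.Im z|.
Proof.
case: z => a b /=; rewrite -[leRHS]ger0_norm ?addr_ge0 ?normr_ge0//.
rewrite -[leRHS]sqrtr_sqr ler_sqrt ?sqr_ge0//.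
rewrite sqrrD !real_normK ?num_real// -addrA [_ *+ 2 + _]addrC addrA lerDl.
by rewrite mulrn_wge0// mulr_ge0 ?normr_ge0.
Qed.

(** The norm of the normed module [R[i]^o] is [R[i]]-valued; this lemma and the
    next ones trade it for the real-valued modulus, so that all estimates can be
    made with real radii. *)
Lemma nbhs_normcP (z : R[i]^o) (P : set R[i]^o) :
  nbhs z P <-> exists2 d : R, 0 < d & forall w, normc (w - z) < d -> P w.
Proof.
rewrite nbhs_ballP; split=> [[e /= e0 ezP]|[d d0 dP]].
  have /complex_realP[d ed] : e \is Num.real by rewrite realE ltW.
  move: e0 ezP; rewrite ed ltcR => d0 ezP; exists d => // w wz; apply: ezP.
  by rewrite -ball_normE /ball_ /= ltcR normcB.
exists d%:C; first by rewrite /= ltcR.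
by move=> w; rewrite -ball_normE /ball_ /= ltcR normcB => /dP.
Qed.

Lemma ball_normcE (z w : R[i]^o) (r : R) : ball z r%:C w = (normc (z - w) < r) :> Prop.
Proof. by rewrite -ball_normE /ball_ /= ltcR. Qed.

Lemma cvg_normcP {T : Type} (F : set_system T) {FF : Filter F} (f : T -> R[i]^o)
    (l : R[i]^o) :
  f @ F --> l <-> forall e : R, 0 < e -> \forall t \near F, normc (f t - l) < e.
Proof.
split=> [fl e e0|fl A /nbhs_normcP[d d0 dA]].
  by apply: (fl [set w | normc (w - l) < e]); apply/nbhs_normcP; exists e.
by apply: filterS (fl _ d0) => t /dA.
Qed.

Lemma Re_continuous : continuous (fun z : R[i]^o => complex.Re z).
Proof.
move=> z; apply/(@cvgrPdist_lt _ _ _ (nbhs z)) => e e0; apply/nbhs_normcP; exists e => // w wz.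
by rewrite -raddfB; apply: le_lt_trans (normRe _) _; rewrite normcB.
Qed.

Lemma Im_continuous : continuous (fun z : R[i]^o => complex.Im z).
Proof.
move=> z; apply/(@cvgrPdist_lt _ _ _ (nbhs z)) => e e0; apply/nbhs_normcP; exists e => // w wz.
by rewrite -raddfB; apply: le_lt_trans (normIm _) _; rewrite normcB.
Qed.

Lemma horizontal_continuous (y : R) : continuous (fun t : R => (t +i* y : R[i]^o)).
Proof.
move=> t; apply/cvg_normcP => e e0; near=> u.
rewrite [_ - _](_ : _ = (u - t)%:C) ?normc_real; last first.
  by apply/eqP; rewrite eq_complex /= subrr !eqxx.
by rewrite distrC; near: u; exact: (nbhsx_ballx t e e0).
Unshelve. all: by end_near. Qed.

Lemma vertical_continuous (x : R) : continuous (fun t : R => (x +i* t : R[i]^o)).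
Proof.
move=> t; apply/cvg_normcP => e e0; near=> u.
rewrite [_ - _](_ : _ = (u - t)%:C * 'i); last first.
  by apply/eqP; rewrite eq_complex /= !(mul0r, mulr0, mulr1, subrr, addr0) !eqxx.
rewrite normcM normc_real /normc /= expr0n expr1n add0r sqrtr1 mulr1.
by rewrite distrC; near: u; exact: (nbhsx_ballx t e e0).
Unshelve. all: by end_near. Qed.

End ComplexNorm.

(** * Integrals of complex-valued functions on a segment *)

Section SegmentIntegral.
Context {R : realType}.
Implicit Types (phi psi : R -> R[i]^o) (a b c : R).

Definition cintegral phi a b : R[i] :=
  \int[lebesgue_measure]_(t in `[a, b]) complex.Re (phi t)
  +i* \int[lebesgue_measure]_(t in `[a, b]) complex.Im (phi t).

Definition cont_itv phi a b := forall t, a <= t <= b -> {for t, continuous phi}.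

Lemma cont_itv_Re phi a b : cont_itv phi a b ->
  lebesgue_measure.-integrable `[a, b] (EFin \o (fun t => complex.Re (phi t))).
Proof.
move=> cphi; apply: continuous_compact_integrable; first exact: segment_compact.
apply: continuous_in_subspaceT => t; rewrite inE /= in_itv /= => tab.
apply: (@continuous_comp _ _ _ phi); [exact: cphi|exact: Re_continuous].
Qed.

Lemma cont_itv_Im phi a b : cont_itv phi a b ->
  lebesgue_measure.-integrable `[a, b] (EFin \o (fun t => complex.Im (phi t))).
Proof.
move=> cphi; apply: continuous_compact_integrable; first exact: segment_compact.
apply: continuous_in_subspaceT => t; rewrite inE /= in_itv /= => tab.
apply: (@continuous_comp _ _ _ phi); [exact: cphi|exact: Im_continuous].
Qed.

Lemma cont_itvM phi psi a b : cont_itv phi a b -> cont_itv psi a b ->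
  cont_itv (fun t => phi t * psi t) a b.
Proof. by move=> c1 c2 t tab; apply: cvgM; [exact: c1|exact: c2]. Qed.

Lemma cont_itv_cst (k : R[i]^o) a b : cont_itv (fun _ => k) a b.
Proof. by move=> t _; exact: cvg_cst. Qed.

Lemma cont_itvZ (k : R[i]^o) phi a b : cont_itv phi a b ->
  cont_itv (fun t => k * phi t) a b.
Proof. by move=> c1; exact: (cont_itvM (@cont_itv_cst k a b) c1). Qed.

Lemma cont_itvB phi psi a b : cont_itv phi a b -> cont_itv psi a b ->
  cont_itv (fun t => phi t - psi t) a b.
Proof. by move=> c1 c2 t tab; apply: cvgB; [exact: c1|exact: c2]. Qed.

Lemma eq_cintegral phi psi a b : (forall t, a <= t <= b -> phi t = psi t) ->
  cintegral phi a b = cintegral psi a b.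
Proof.
move=> e; congr (_ +i* _); apply: eq_Rintegral => t; rewrite inE /= in_itv /= => tab.
  by rewrite e.
by rewrite e.
Qed.

Lemma cintegralD phi psi a b : cont_itv phi a b -> cont_itv psi a b ->
  cintegral (fun t => phi t + psi t) a b = cintegral phi a b + cintegral psi a b.
Proof.
move=> c1 c2; rewrite /cintegral; simpc; congr (_ +i* _); rewrite -RintegralD//;
 by [exact: cont_itv_Re|exact: cont_itv_Im|apply: eq_Rintegral => t _; rewrite raddfD].
Qed.

Lemma cintegralZ k phi a b : cont_itv phi a b ->
  cintegral (fun t => k * phi t) a b = k * cintegral phi a b.
Proof.
move=> c1; case: k => k l; rewrite /cintegral; simpc.
have [iR iI] := (cont_itv_Re c1, cont_itv_Im c1).
rewrite -!RintegralZl//; congr (_ +i* _); rewrite -?RintegralB -?RintegralD//.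
- by apply: eq_Rintegral => t _; case: (phi t).
- exact: (integrableZl _ k iR).
- exact: (integrableZl _ l iI).
- by apply: eq_Rintegral => t _; case: (phi t).
- exact: (integrableZl _ k iI).
- exact: (integrableZl _ l iR).
Qed.

Lemma lebesgue_segment a b : a <= b -> fine (@lebesgue_measure R `[a, b]) = b - a.
Proof.
move=> ab; rewrite lebesgue_measure_itv /= lte_fin.
by case: ltgtP ab => // -> _; rewrite /= subrr.
Qed.

Lemma cintegral_cst k a b : a <= b -> cintegral (fun _ => k) a b = k * (b - a)%:C.
Proof.
move=> ab; rewrite /cintegral !Rintegral_cst// lebesgue_segment//.
by case: k => k l /=; simpc.
Qed.

Lemma Rintegral_chasles (f : R -> R) a b c : a <= b -> b <= c ->
  lebesgue_measure.-integrable `[a, c] (EFin \o f) ->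
  \int[lebesgue_measure]_(t in `[a, c]) f t =
    \int[lebesgue_measure]_(t in `[a, b]) f t + \int[lebesgue_measure]_(t in `[b, c]) f t.
Proof.
move=> ab bc itf; apply/eqP; rewrite addrC -subr_eq.
rewrite Rintegral_itvB ?bnd_simp//; apply/eqP; apply: Rintegral_itv_obnd_cbnd.
apply: integrableS itf => //.
by apply: subset_itv; rewrite bnd_simp.
Qed.

Lemma cintegral_chasles phi a b c : a <= b -> b <= c -> cont_itv phi a c ->
  cintegral phi a c = cintegral phi a b + cintegral phi b c.
Proof.
move=> ab bc c1; rewrite /cintegral; simpc.
by congr (_ +i* _); apply: Rintegral_chasles => //; [exact: cont_itv_Re|exact: cont_itv_Im].
Qed.

Lemma Re_cintegral_le phi a b M : a <= b -> cont_itv phi a b ->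
  (forall t, a <= t <= b -> complex.Re (phi t) <= M) ->
  complex.Re (cintegral phi a b) <= M * (b - a).
Proof.
move=> ab c1 leM; rewrite -(lebesgue_segment ab) -Rintegral_cst//=.
apply: le_Rintegral => //; first exact: cont_itv_Re.
  exact: (cont_itv_Re (@cont_itv_cst M%:C a b)).
Qed.

(** The integral is rotated onto the positive real axis, where its modulus is
    its real part. *)
Lemma normc_cintegral_le phi a b M : a <= b -> cont_itv phi a b ->
  (forall t, a <= t <= b -> normc (phi t) <= M) ->
  normc (cintegral phi a b) <= M * (b - a).
Proof.
move=> ab c1 leM; set z := cintegral phi a b.
have [z0|z0] := eqVneq z 0.
  rewrite z0 normc0 mulr_ge0 ?subr_ge0//.
  by apply: le_trans (leM a _); rewrite ?normc_ge0// lexx.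
pose u : R[i]^o := (normc z)%:C / z.
have nu : normc u = 1.
  by rewrite normcM normcV normc_real ger0_norm ?normc_ge0// divff// normc_eq0.
have uz : u * z = (normc z)%:C by rewrite /u divfK.
have -> : normc z = complex.Re (cintegral (fun t => u * phi t) a b).
  by rewrite cintegralZ// -/z uz.
apply: (Re_cintegral_le ab (@cont_itvZ u _ _ _ c1)) => t tab.
 apply: le_trans (ler_norm _) _; apply: le_trans (normRe _) _.
by rewrite normcM nu mul1r leM.
Qed.

End SegmentIntegral.

(** * Contour integrals along rectangles and Goursat's theorem *)

Section Goursat.
Context {R : realType}.
Implicit Types (f g : R[i]^o -> R[i]^o) (x y a b : R) (p z w k l : R[i]^o).

Definition frame x0 x1 y0 y1 : set R[i]^o := [set p : R[i] |
  x0 <= complex.Re p <= x1 /\ (complex.Im p = y0 \/ complex.Im p = y1) \/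
  y0 <= complex.Im p <= y1 /\ (complex.Re p = x0 \/ complex.Re p = x1)].

Definition rectangle x0 x1 y0 y1 : set R[i]^o :=
  [set p : R[i] | x0 <= complex.Re p <= x1 /\ y0 <= complex.Im p <= y1].

Definition continuous_on (A : set R[i]^o) f := forall p, A p -> {for p, continuous f}.

(** The contour integral of [f] along the boundary of a rectangle.  Opposite
    sides are paired inside one integral, so that an affine [f] yields constant
    integrands. *)
Definition rect_integral f x0 x1 y0 y1 : R[i]^o :=
  cintegral (fun x => f (x +i* y0) - f (x +i* y1)) x0 x1 +
  'i * cintegral (fun y => f (x1 +i* y) - f (x0 +i* y)) y0 y1.

Lemma frame_rectangle x0 x1 y0 y1 : x0 <= x1 -> y0 <= y1 ->
  frame x0 x1 y0 y1 `<=` rectangle x0 x1 y0 y1.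
Proof.
move=> x01 y01 p [[px [py|py]]|[py [px|px]]]; split=> //.
- by rewrite py lexx.
- by rewrite py lexx andbT.
- by rewrite px lexx.
- by rewrite px lexx andbT.
Qed.

Lemma continuous_onS (A B : set R[i]^o) f : A `<=` B ->
  continuous_on B f -> continuous_on A f.
Proof. by move=> AB cf p /AB /cf. Qed.

Lemma continuous_onD (A : set R[i]^o) f g : continuous_on A f -> continuous_on A g ->
  continuous_on A (fun z => f z + g z).
Proof. by move=> cf cg p Ap; exact: (continuousD (cf p Ap) (cg p Ap)). Qed.

Lemma continuous_onB (A : set R[i]^o) f g : continuous_on A f -> continuous_on A g ->
  continuous_on A (fun z => f z - g z).
Proof. by move=> cf cg p Ap; exact: (continuousB (cf p Ap) (cg p Ap)). Qed.

Lemma continuous_onM (A : set R[i]^o) f g : continuous_on A f -> continuous_on A g ->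
  continuous_on A (fun z => f z * g z).
Proof. by move=> cf cg p Ap; exact: (continuousM (cf p Ap) (cg p Ap)). Qed.

Lemma continuous_on_cst (A : set R[i]^o) k : continuous_on A (fun _ => k).
Proof. by move=> p _; exact: cst_continuous. Qed.

Lemma continuous_on_id (A : set R[i]^o) : continuous_on A id.
Proof. by move=> p _ P. Qed.

Lemma continuous_onV (A : set R[i]^o) f : (forall p, A p -> f p != 0) ->
  continuous_on A f -> continuous_on A (fun z => (f z)^-1).
Proof. by move=> f0 cf p Ap; exact: (continuousV (f0 p Ap) (cf p Ap)). Qed.

Lemma cont_itv_hor f a b y : (forall t, a <= t <= b -> {for (t +i* y : R[i]^o), continuous f}) ->
  cont_itv (fun t => f (t +i* y)) a b.
Proof.
move=> cf t tab; apply: (@continuous_comp _ _ _ (fun t : R => (t +i* y : R[i]^o)) f).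
  exact: horizontal_continuous.
exact: cf.
Qed.

Lemma cont_itv_ver f a b x : (forall t, a <= t <= b -> {for (x +i* t : R[i]^o), continuous f}) ->
  cont_itv (fun t => f (x +i* t)) a b.
Proof.
move=> cf t tab; apply: (@continuous_comp _ _ _ (fun t : R => (x +i* t : R[i]^o)) f).
  exact: vertical_continuous.
exact: cf.
Qed.

Lemma frame_sides x0 x1 y0 y1 f : continuous_on (frame x0 x1 y0 y1) f ->
  [/\ cont_itv (fun x => f (x +i* y0)) x0 x1, cont_itv (fun x => f (x +i* y1)) x0 x1,
      cont_itv (fun y => f (x0 +i* y)) y0 y1 & cont_itv (fun y => f (x1 +i* y)) y0 y1].
Proof.
move=> cf; split.
- by apply: cont_itv_hor => t tab; apply: cf; left; split; [|left].
- by apply: cont_itv_hor => t tab; apply: cf; left; split; [|right].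
- by apply: cont_itv_ver => t tab; apply: cf; right; split; [|left].
- by apply: cont_itv_ver => t tab; apply: cf; right; split; [|right].
Qed.

Lemma rect_integralD f g x0 x1 y0 y1 :
  continuous_on (frame x0 x1 y0 y1) f -> continuous_on (frame x0 x1 y0 y1) g ->
  rect_integral (fun z => f z + g z) x0 x1 y0 y1 =
  rect_integral f x0 x1 y0 y1 + rect_integral g x0 x1 y0 y1.
Proof.
move=> /frame_sides[f1 f2 f3 f4] /frame_sides[g1 g2 g3 g4].
rewrite /rect_integral addrACA -mulrDr -!cintegralD; try exact: cont_itvB.
by congr (_ + _ * _); apply: eq_cintegral => t _; rewrite addrACA opprD.
Qed.

Lemma rect_integralZ k f x0 x1 y0 y1 : continuous_on (frame x0 x1 y0 y1) f ->
  rect_integral (fun z => k * f z) x0 x1 y0 y1 = k * rect_integral f x0 x1 y0 y1.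
Proof.
move=> /frame_sides[f1 f2 f3 f4].
rewrite /rect_integral mulrDr mulrCA.
rewrite -(cintegralZ k (cont_itvB f1 f2)) -(cintegralZ k (cont_itvB f4 f3)).
by congr (_ + _ * _); apply: eq_cintegral => t _; rewrite mulrBr.
Qed.

Lemma rect_integralB f g x0 x1 y0 y1 :
  continuous_on (frame x0 x1 y0 y1) f -> continuous_on (frame x0 x1 y0 y1) g ->
  rect_integral (fun z => f z - g z) x0 x1 y0 y1 =
  rect_integral f x0 x1 y0 y1 - rect_integral g x0 x1 y0 y1.
Proof.
move=> cf cg.
have := rect_integralD cf (continuous_onM (@continuous_on_cst _ (-1)) cg).
rewrite rect_integralZ// mulN1r => <-.
by congr rect_integral; apply/funext => z; rewrite mulN1r.
Qed.

Lemma eq_rect_integral f g x0 x1 y0 y1 : (forall p, frame x0 x1 y0 y1 p -> f p = g p) ->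
  rect_integral f x0 x1 y0 y1 = rect_integral g x0 x1 y0 y1.
Proof.
move=> fg; congr (_ + _ * _); apply: eq_cintegral => t tab; rewrite !fg//.
- by left; split; [|right].
- by left; split; [|left].
- by right; split; [|left].
- by right; split; [|right].
Qed.

Lemma normc_rect_integral_le f x0 x1 y0 y1 M : x0 <= x1 -> y0 <= y1 ->
  continuous_on (frame x0 x1 y0 y1) f ->
  (forall p, frame x0 x1 y0 y1 p -> normc (f p) <= M) ->
  normc (rect_integral f x0 x1 y0 y1) <= 2 * M * ((x1 - x0) + (y1 - y0)).
Proof.
move=> x01 y01 /frame_sides[f1 f2 f3 f4] fM.
apply: le_trans (le_normcD _ _) _; rewrite normcM.
rewrite [normc 'i](_ : _ = 1) ?mul1r; last by rewrite /normc /= expr0n expr1n add0r sqrtr1.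
rewrite [leRHS]mulrDr; apply: lerD.
  apply: (normc_cintegral_le x01 (cont_itvB f1 f2)) => t tab.
  apply: le_trans (ler_normcB _ _) _; rewrite mulr_natl mulr2n.
  by apply: lerD; apply: fM; left; split=> //; [left|right].
apply: (normc_cintegral_le y01 (cont_itvB f4 f3)) => t tab.
apply: le_trans (ler_normcB _ _) _; rewrite mulr_natl mulr2n.
by apply: lerD; apply: fM; right; split=> //; [right|left].
Qed.

Lemma rect_integral_affine k l x0 x1 y0 y1 : x0 <= x1 -> y0 <= y1 ->
  rect_integral (fun z => k + l * z) x0 x1 y0 y1 = 0.
Proof.
move=> x01 y01; rewrite /rect_integral.
rewrite (@eq_cintegral _ _ (fun _ => l * (0 +i* (y0 - y1)))); last first.
  move=> t _; rewrite opprD addrACA subrr add0r -mulrBr; congr (_ * _).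
  by apply/eqP; rewrite eq_complex /= subrr !eqxx.
rewrite [X in _ + _ * X](@eq_cintegral _ _ (fun _ => l * ((x1 - x0)%:C))); last first.
  move=> t _; rewrite opprD addrACA subrr add0r -mulrBr; congr (_ * _).
  by apply/eqP; rewrite eq_complex /= subrr !eqxx.
rewrite !cintegral_cst// -[in LHS]mulrA [X in _ + X]mulrCA -[in X in _ + X]mulrA -mulrDr.
rewrite (_ : _ + _ = 0) ?mulr0//.
by apply/eqP; rewrite eq_complex /=; apply/andP; split; apply/eqP; ring.
Qed.

Lemma rect_integral_split_x f x0 x1 x2 y0 y1 : x0 <= x1 -> x1 <= x2 -> y0 <= y1 ->
  continuous_on (rectangle x0 x2 y0 y1) f ->
  rect_integral f x0 x2 y0 y1 = rect_integral f x0 x1 y0 y1 + rect_integral f x1 x2 y0 y1.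
Proof.
move=> x01 x12 y01 cf.
have hor y : y0 <= y <= y1 -> cont_itv (fun x => f (x +i* y)) x0 x2.
  by move=> yy; apply: cont_itv_hor => t tab; apply: cf; split.
have ver x : x0 <= x <= x2 -> cont_itv (fun y => f (x +i* y)) y0 y1.
  by move=> xx; apply: cont_itv_ver => t tab; apply: cf; split.
rewrite /rect_integral addrACA -mulrDr (@cintegral_chasles _ _ x0 x1 x2)//; last first.
  by apply: cont_itvB; apply: hor; rewrite lexx ?andbT.
congr (_ + _ * _); rewrite -cintegralD.
- by apply: eq_cintegral => t _; rewrite [RHS]addrC addrA subrK.
- by apply: cont_itvB; apply: ver; rewrite ?lexx ?x01 ?x12 ?(le_trans x01 x12).
- by apply: cont_itvB; apply: ver; rewrite ?lexx ?x01 ?x12 ?(le_trans x01 x12).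
Qed.

Lemma rect_integral_split_y f x0 x1 y0 y1 y2 : x0 <= x1 -> y0 <= y1 -> y1 <= y2 ->
  continuous_on (rectangle x0 x1 y0 y2) f ->
  rect_integral f x0 x1 y0 y2 = rect_integral f x0 x1 y0 y1 + rect_integral f x0 x1 y1 y2.
Proof.
move=> x01 y01 y12 cf.
have hor y : y0 <= y <= y2 -> cont_itv (fun x => f (x +i* y)) x0 x1.
  by move=> yy; apply: cont_itv_hor => t tab; apply: cf; split.
have ver x : x0 <= x <= x1 -> cont_itv (fun y => f (x +i* y)) y0 y2.
  by move=> xx; apply: cont_itv_ver => t tab; apply: cf; split.
rewrite /rect_integral addrACA -mulrDr -(@cintegral_chasles _ _ y0 y1 y2)//; last first.
  by apply: cont_itvB; apply: ver; rewrite lexx ?andbT.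
congr (_ + _ * _); rewrite -cintegralD.
- by apply: eq_cintegral => t _; rewrite addrA subrK.
- by apply: cont_itvB; apply: hor; rewrite ?lexx ?y01 ?y12 ?(le_trans y01 y12).
- by apply: cont_itvB; apply: hor; rewrite ?lexx ?y01 ?y12 ?(le_trans y01 y12).
Qed.

Definition cdiff f p := exists l : R[i], forall e : R, 0 < e -> exists2 d : R, 0 < d &
  forall w, normc (w - p) < d -> normc (f w - f p - l * (w - p)) <= e * normc (w - p).

Lemma cdiff_continuous f p : cdiff f p -> {for p, continuous f}.
Proof.
move=> [l fl]; have [d d0 fd] := fl 1 ltr01.
apply/(@cvg_normcP _ _ (nbhs p)) => e e0; apply/nbhs_normcP.
have n0 : 0 < normc l + 1 by rewrite ltr_wpDl ?normc_ge0.
exists (Order.min d (e / (normc l + 1))); first by rewrite lt_min d0 divr_gt0.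
move=> w; rewrite lt_min => /andP[/fd wd we].
rewrite -[f w - f p](subrK (l * (w - p))); apply: le_lt_trans (le_normcD _ _) _.
rewrite normcM; apply: le_lt_trans (lerD wd (lexx _)) _.
by rewrite -mulrDl [1 + _]addrC mulrC -ltr_pdivlMr.
Qed.


Lemma nested_intervals (a b : nat -> R) :
  (forall n, a n <= a n.+1) -> (forall n, b n.+1 <= b n) -> (forall n, a n <= b n) ->
  exists x, forall n, a n <= x <= b n.
Proof.
move=> ha hb hab.
have na : {homo a : m n / (m <= n)%N >-> m <= n} by exact/nondecreasing_seqP.
have nb : {homo b : m n / (m <= n)%N >-> n <= m} by exact/nonincreasing_seqP.
have ub m n : a n <= b m.
  apply: le_trans (na _ _ (leq_maxl n m)) _.
  by apply: le_trans (hab _) (nb _ _ (leq_maxr n m)).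
have hs : has_sup (range a).
  by split; [exists (a 0%N); exists 0%N|exists (b 0%N) => _ [n _ <-]].
exists (sup (range a)) => n; apply/andP; split.
  by apply: ub_le_sup; [case: hs|exists n].
by apply: ge_sup; [case: hs|move=> _ [m _ <-]].
Qed.

(** The bisection step of Goursat's argument: the integrals along the four
    quarters add up to the integral along the rectangle. *)
Lemma quarter_rectangle f x y a b : 0 <= a -> 0 <= b ->
  continuous_on (rectangle x (x + 2 * a) y (y + 2 * b)) f ->
  exists q : R * R, [/\ x <= q.1 <= x + a, y <= q.2 <= y + b &
    normc (rect_integral f x (x + 2 * a) y (y + 2 * b)) <=
    4 * normc (rect_integral f q.1 (q.1 + a) q.2 (q.2 + b))].
Proof.
move=> a0 b0 cf.
have sub x0 x1 y0 y1 : x <= x0 -> x1 <= x + 2 * a -> y <= y0 -> y1 <= y + 2 * b ->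
    continuous_on (rectangle x0 x1 y0 y1) f.
  move=> h1 h2 h3 h4; apply: continuous_onS cf => p /= [/andP[p1 p2] /andP[p3 p4]].
  by split; apply/andP; split; lra.
set I := rect_integral f.
have -> : I x (x + 2 * a) y (y + 2 * b) =
   (I x (x + a) y (y + b) + I x (x + a) (y + b) (y + b + b)) +
   (I (x + a) (x + a + a) y (y + b) + I (x + a) (x + a + a) (y + b) (y + b + b)).
  rewrite /I (@rect_integral_split_x _ x (x + a)); [|lra|lra|lra|exact: cf].
  rewrite (@rect_integral_split_y _ x _ y (y + b)); [|lra|lra|lra|by apply: sub; lra].
  rewrite (@rect_integral_split_y _ (x + a) _ y (y + b)); [|lra|lra|lra|by apply: sub; lra].
  have -> : x + 2 * a = x + a + a by lra.
  by have -> : y + 2 * b = y + b + b by lra.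
set A := I _ _ _ _; set B := I _ _ _ _; set C := I _ _ _ _; set D := I _ _ _ _.
have le4 : normc (A + B + (C + D)) <= normc A + normc B + (normc C + normc D).
  by apply: le_trans (le_normcD _ _) _; apply: lerD; exact: le_normcD.
have [hA|hA] := leP (normc (A + B + (C + D))) (4 * normc A).
  by exists (x, y); split; [move=> /=; lra|move=> /=; lra|exact: hA].
have [hB|hB] := leP (normc (A + B + (C + D))) (4 * normc B).
  by exists (x, y + b); split; [move=> /=; lra|move=> /=; lra|exact: hB].
have [hC|hC] := leP (normc (A + B + (C + D))) (4 * normc C).
  by exists (x + a, y); split; [move=> /=; lra|move=> /=; lra|exact: hC].
have hD : normc (A + B + (C + D)) <= 4 * normc D by clear -le4 hA hB hC; lra.
by exists (x + a, y + b); split; [move=> /=; lra|move=> /=; lra|exact: hD].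
Qed.

Lemma exists_div_exp2_lt (S d : R) : 0 < d -> exists n, S / 2 ^+ n < d.
Proof.
move=> d0; exists (Num.truncn (S / d)).+1.
rewrite ltr_pdivrMr ?exprn_gt0// mulrC -ltr_pdivrMr//.
apply: lt_trans (truncnS_gt _) _.
by rewrite -natrX ltr_nat ltn_expl.
Qed.

(** Goursat: bisecting produces nested rectangles of scale [2 ^- n] whose
    integrals decay no faster than [4 ^- n], while differentiability at the
    common point makes them [o(4 ^- n)], the affine part integrating to zero. *)
Lemma goursat f x0 x1 y0 y1 : x0 <= x1 -> y0 <= y1 ->
  (forall p, rectangle x0 x1 y0 y1 p -> cdiff f p) -> rect_integral f x0 x1 y0 y1 = 0.
Proof.
move=> x01 y01 df.
have cf : continuous_on (rectangle x0 x1 y0 y1) f by move=> p /df; exact: cdiff_continuous.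
pose W n := (x1 - x0) / 2 ^+ n; pose H n := (y1 - y0) / 2 ^+ n.
have W0 n : 0 <= W n by rewrite divr_ge0 ?subr_ge0.
have H0 n : 0 <= H n by rewrite divr_ge0 ?subr_ge0.
have WS n : W n = 2 * W n.+1 by rewrite /W exprS invfM mulrCA mulVKf.
have HS n : H n = 2 * H n.+1 by rewrite /H exprS invfM mulrCA mulVKf.
pose inQ n (q : R * R) := [/\ x0 <= q.1, q.1 + W n <= x1, y0 <= q.2 & q.2 + H n <= y1].
pose I n (q : R * R) := rect_integral f q.1 (q.1 + W n) q.2 (q.2 + H n).
have step n (q : R * R) : exists q' : R * R, inQ n q ->
    [/\ q.1 <= q'.1 <= q.1 + W n.+1, q.2 <= q'.2 <= q.2 + H n.+1 &
        normc (I n q) <= 4 * normc (I n.+1 q')].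
  have [[h1 h2 h3 h4]|nQ] := pselect (inQ n q); last by exists q.
  have [|q' qP] := @quarter_rectangle f q.1 q.2 (W n.+1) (H n.+1) (W0 _) (H0 _).
    rewrite -WS -HS; apply: continuous_onS cf => p /= [/andP[p1 p2] /andP[p3 p4]].
    by split; apply/andP; split; lra.
  by exists q' => _; move: qP; rewrite -WS -HS.
pose next n q := projT1 (cid (step n q)).
pose Q := fix Q n := if n is m.+1 then next m (Q m) else (x0, y0).
have QS n : inQ n (Q n) -> [/\ (Q n).1 <= (Q n.+1).1 <= (Q n).1 + W n.+1,
    (Q n).2 <= (Q n.+1).2 <= (Q n).2 + H n.+1 & normc (I n (Q n)) <= 4 * normc (I n.+1 (Q n.+1))].
  exact: (projT2 (cid (step n (Q n)))).
have inQn n : inQ n (Q n).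
  elim: n => [|n IH]; first by split; rewrite /= ?lexx// /W /H expr0 divr1 addrC subrK lexx.
  have [/andP[a1 a2] /andP[a3 a4] _] := QS n IH; case: IH => b1 b2 b3 b4.
  by have := WS n; have := HS n; split; lra.
(* No more than a factor [4] is lost at each bisection. *)
have IQ n : normc (I 0%N (x0, y0)) <= 4 ^+ n * normc (I n (Q n)).
  elim: n => [|n IH]; first by rewrite expr0 mul1r.
  apply: le_trans IH _; rewrite exprSr -mulrA ler_pM2l ?exprn_gt0//.
  by case: (QS n (inQn n)).
have [X hX] : exists X, forall n, (Q n).1 <= X <= (Q n).1 + W n.
  apply: nested_intervals => n; have [/andP[a1 a2] /andP[a3 a4] _] := QS n (inQn n).
  - by [].
  - by have := WS n; lra.
  - by have := W0 n; lra.
have [Y hY] : exists Y, forall n, (Q n).2 <= Y <= (Q n).2 + H n.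
  apply: nested_intervals => n; have [/andP[a1 a2] /andP[a3 a4] _] := QS n (inQn n).
  - by [].
  - by have := HS n; lra.
  - by have := H0 n; lra.
pose P : R[i]^o := X +i* Y.
have PQ : rectangle x0 x1 y0 y1 P.
  have := hX 0%N; have := hY 0%N; rewrite /= /W /H expr0 !divr1 !subrKC => hy hx.
  by split.
have [l fl] := df P PQ.
have small e : 0 < e -> normc (I 0%N (x0, y0)) <= e * (2 * ((x1 - x0) + (y1 - y0)) ^+ 2).
  move=> e0; have [d d0 fd] := fl e e0.
  pose S := (x1 - x0) + (y1 - y0); have S0 : 0 <= S by rewrite addr_ge0 ?subr_ge0.
  have [n nS] := exists_div_exp2_lt S d0.
  have WHS : W n + H n = S / 2 ^+ n by rewrite /W /H /S -mulrDl.
  case: (inQn n) => b1 b2 b3 b4.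
  have QW : (Q n).1 <= (Q n).1 + W n by rewrite lerDl.
  have QH : (Q n).2 <= (Q n).2 + H n by rewrite lerDl.
  have frameQ p : frame (Q n).1 ((Q n).1 + W n) (Q n).2 ((Q n).2 + H n) p ->
      rectangle (Q n).1 ((Q n).1 + W n) (Q n).2 ((Q n).2 + H n) p.
    exact: frame_rectangle.
  have cfQ : continuous_on (frame (Q n).1 ((Q n).1 + W n) (Q n).2 ((Q n).2 + H n)) f.
    apply: continuous_onS cf => p /frameQ [/andP[p1 p2] /andP[p3 p4]].
    by split; apply/andP; split; lra.
  pose L z := f P - l * P + l * z.
  have cL : continuous_on (frame (Q n).1 ((Q n).1 + W n) (Q n).2 ((Q n).2 + H n)) L.
    apply: continuous_onD; first exact: continuous_on_cst.
    by apply: continuous_onM; [exact: continuous_on_cst|exact: continuous_on_id].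
  (* The affine approximation [L] of [f] at the common point is subtracted. *)
  have IE : I n (Q n) = rect_integral (fun z => f z - L z)
      (Q n).1 ((Q n).1 + W n) (Q n).2 ((Q n).2 + H n).
    by rewrite (rect_integralB cfQ cL) rect_integral_affine// subr0.
  have IM : normc (I n (Q n)) <= 2 * (e * (S / 2 ^+ n)) * (S / 2 ^+ n).
    have -> : S / 2 ^+ n = ((Q n).1 + W n - (Q n).1) + ((Q n).2 + H n - (Q n).2).
      by rewrite -WHS; ring.
    rewrite IE; apply: (normc_rect_integral_le QW QH (continuous_onB cfQ cL)).
    move=> p /frameQ[pX pY].
    have -> : f p - L p = f p - f P - l * (p - P) by rewrite /L; ring.
    have pP : normc (p - P) <= S / 2 ^+ n.
      apply: le_trans (normc_ReIm _) _; rewrite -WHS !raddfB /=.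
      have := hX n; have := hY n; move: pX pY.
      move=> /andP[p1 p2] /andP[p3 p4] /andP[q1 q2] /andP[q3 q4].
      by apply: lerD; rewrite ler_norml; apply/andP; split; lra.
    apply: le_trans (fd _ _) _; first exact: le_lt_trans nS.
    rewrite ler_pM2l//; apply: le_trans pP _; rewrite -WHS.
    by rewrite le_eqVlt; apply/orP; left; apply/eqP; ring.
  apply: le_trans (IQ n) _.
  apply: le_trans (ler_wpM2l _ IM) _; first by rewrite exprn_ge0.
  rewrite le_eqVlt; apply/orP; left; apply/eqP.
  have -> : (4 : R) = 2 * 2 by rewrite -natrM.
  have n2 : (2 : R) ^+ n != 0 by rewrite expf_neq0.
  by rewrite exprMn -/S; field.
have {}small : normc (rect_integral f x0 x1 y0 y1) <= 0.
  set K := 2 * ((x1 - x0) + (y1 - y0)) ^+ 2 in small.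
  have K0 : 0 <= K by rewrite mulr_ge0// sqr_ge0.
  apply/ler_addgt0Pl => e e0; rewrite addr0.
  have := small (e / (K + 1)) (divr_gt0 e0 (ltr_wpDl K0 ltr01)).
  rewrite {1}/I /W /H expr0 !divr1 /= !subrKC => /le_trans; apply.
  by rewrite mulrAC ler_pdivrMr ?ltr_wpDl// ler_pM2l// lerDl ler01.
exact (normc_le0 small).
Qed.

(** A point where [f] is only continuous is harmless: cutting out a square of
    side [2 * h] around it leaves rectangles covered by Goursat, and the square
    contributes [O(h)]. *)
Lemma goursat_exceptional f x0 x1 y0 y1 a b : x0 < a < x1 -> y0 < b < y1 ->
  continuous_on (rectangle x0 x1 y0 y1) f ->
  (forall p, rectangle x0 x1 y0 y1 p -> p <> a +i* b -> cdiff f p) ->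
  rect_integral f x0 x1 y0 y1 = 0.
Proof.
move=> /andP[xa ax] /andP[yb by1] cf df.
set z : R[i]^o := a +i* b.
have Rz : rectangle x0 x1 y0 y1 z by split; rewrite /= !ltW.
have [d d0 fd] : exists2 d : R, 0 < d & forall w, normc (w - z) < d -> normc (f w - f z) < 1.
  by have /(@cvg_normcP _ _ (nbhs z))/(_ 1 ltr01)/nbhs_normcP := cf z Rz.
set M := normc (f z) + 1.
have fM w : normc (w - z) < d -> normc (f w) <= M.
  move=> /fd fw; rewrite -[f w](subrK (f z)); apply: le_trans (le_normcD _ _) _.
  by rewrite /M addrC lerD2l ltW.
have M0 : 0 < M by rewrite /M ltr_wpDl ?normc_ge0.
suff small : normc (rect_integral f x0 x1 y0 y1) <= 0.
  exact (normc_le0 small).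
apply/ler_addgt0Pl => e e0; rewrite addr0.
pose m1 := Order.min (Order.min (a - x0) (x1 - a)) (Order.min (b - y0) (y1 - b)).
pose h := Order.min (Order.min (d / 3) (e / (8 * M))) m1.
have h0 : 0 < h by rewrite !lt_min !subr_gt0 xa ax yb by1 !divr_gt0// mulr_gt0.
have [[hd he] [ha ha' hb hb']] : (h <= d / 3 /\ h <= e / (8 * M)) /\
    [/\ h <= a - x0, h <= x1 - a, h <= b - y0 & h <= y1 - b].
  have : h <= h by []; rewrite {2}/h /m1 !le_min => /andP[/andP[-> ->]] /andP[/andP[-> ->]].
  by move=> /andP[-> ->].
have sub X0 X1 Y0 Y1 : x0 <= X0 -> X1 <= x1 -> y0 <= Y0 -> Y1 <= y1 ->
    rectangle X0 X1 Y0 Y1 `<=` rectangle x0 x1 y0 y1.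
  move=> h1 h2 h3 h4 p /= [/andP[p1 p2] /andP[p3 p4]].
  by split; apply/andP; split; lra.
have zero X0 X1 Y0 Y1 : x0 <= X0 -> X1 <= x1 -> y0 <= Y0 -> Y1 <= y1 -> X0 <= X1 -> Y0 <= Y1 ->
    ~ rectangle X0 X1 Y0 Y1 z -> rect_integral f X0 X1 Y0 Y1 = 0.
  move=> h1 h2 h3 h4 h5 h6 nz; apply: goursat => // p pR; apply: df; first exact: sub pR.
  by move=> pz; apply: nz; rewrite /z -pz.
have [l1 l2 l3] : [/\ x0 <= a - h, a - h <= a + h & a + h <= x1] by clear -ha ha' h0; split; lra.
have [k1 k2 k3] : [/\ y0 <= b - h, b - h <= b + h & b + h <= y1] by clear -hb hb' h0; split; lra.
have [l4 k4 k5] : [/\ a - h <= x1, y0 <= y1 & b - h <= y1].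
  by split; [exact: le_trans l3|rewrite ltW// (lt_trans yb)|exact: le_trans k3].
have E1 := rect_integral_split_x l1 l4 k4 cf.
have Z1 : rect_integral f x0 (a - h) y0 y1 = 0.
  apply: zero => //; move=> [/andP[_ /= ah] _]; clear -h0 ah; lra.
have E2 := rect_integral_split_x l2 l3 k4 (continuous_onS (sub _ _ _ _ l1 (lexx _) (lexx _) (lexx _)) cf).
have Z2 : rect_integral f (a + h) x1 y0 y1 = 0.
  apply: zero => //; first exact: le_trans l2.
  by move=> [/andP[/= ah _] _]; clear -h0 ah; lra.
have E3 := rect_integral_split_y l2 k1 k5 (continuous_onS (sub _ _ _ _ l1 l3 (lexx _) (lexx _)) cf).
have Z3 : rect_integral f (a - h) (a + h) y0 (b - h) = 0.
  by apply: zero => //; move=> [_ /andP[_ /= bh]]; clear -h0 bh; lra.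
have E4 := rect_integral_split_y l2 k2 k3 (continuous_onS (sub _ _ _ _ l1 l3 k1 (lexx _)) cf).
have Z4 : rect_integral f (a - h) (a + h) (b + h) y1 = 0.
  apply: zero => //; first exact: le_trans k2.
  by move=> [_ /andP[/= bh _]]; clear -h0 bh; lra.
rewrite E1 Z1 add0r E2 Z2 addr0 E3 Z3 add0r E4 Z4 addr0.
have fr := frame_rectangle l2 k2.
apply: le_trans (normc_rect_integral_le (M := M) l2 k2 _ _) _.
- by apply: continuous_onS cf => p /fr; exact: sub.
- move=> p /fr[/andP[p1 p2] /andP[p3 p4]]; apply: fM.
  apply: le_lt_trans (normc_ReIm _) _; rewrite !raddfB /=.
  apply: (@le_lt_trans _ _ (h + h)); last lra.
  by apply: lerD; rewrite ler_norml; apply/andP; split; lra.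
move: he; rewrite ler_pdivlMr ?mulr_gt0//; apply: le_trans.
by rewrite le_eqVlt; apply/orP; left; apply/eqP; ring.
Qed.

End Goursat.

(** * Cauchy's formula on a square and local factorization *)

Section CauchyTransform.
Context {R : realType}.
Implicit Types (f g phi : R[i]^o -> R[i]^o) (p z w : R[i]^o).

Lemma Im_cintegral_ge (phi : R -> R[i]^o) (a b M : R) : a <= b -> cont_itv phi a b ->
  (forall t, a <= t <= b -> M <= complex.Im (phi t)) ->
  M * (b - a) <= complex.Im (cintegral phi a b).
Proof.
move=> ab cphi Mphi.
have ImE (u : R[i]) : complex.Im u = - complex.Re ('i * u).
  by case: u => u v /=; rewrite mul0r mul1r sub0r opprK.
rewrite ImE -(cintegralZ 'i cphi) lerNr -mulNr.
apply: (Re_cintegral_le ab (@cont_itvZ _ 'i _ _ _ cphi)) => t /Mphi.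
by rewrite ImE lerNr.
Qed.

Lemma Re_cintegral_ge (phi : R -> R[i]^o) (a b M : R) : a <= b -> cont_itv phi a b ->
  (forall t, a <= t <= b -> M <= complex.Re (phi t)) ->
  M * (b - a) <= complex.Re (cintegral phi a b).
Proof.
move=> ab cphi Mphi.
have ReE (u : R[i]) : complex.Re u = - complex.Re (- 1 * u).
  by rewrite mulN1r raddfN opprK.
rewrite ReE -(cintegralZ (-1) cphi) lerNr -mulNr.
apply: (Re_cintegral_le ab (@cont_itvZ _ (-1) _ _ _ cphi)) => t /Mphi.
by rewrite ReE lerNr.
Qed.

Lemma half_itv (a x r : R) : 0 < r -> - (r / 2) <= a - x -> a - x <= r / 2 ->
  x - r < a < x + r.
Proof. by move=> r0 h1 h2; apply/andP; split; lra. Qed.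

(** The parameter [l] fills in the value at [z], where the quotient is
    meaningless; it will be the derivative of [f] there. *)
Definition divided_difference f z (l : R[i]) : R[i]^o -> R[i]^o :=
  fun w => if w == z then l else (f w - f z) * (w - z)^-1.

Lemma divided_difference_continuous f z (l : R[i]) :
  (forall e : R, 0 < e -> exists2 d : R, 0 < d &
    forall w, normc (w - z) < d -> normc (f w - f z - l * (w - z)) <= e * normc (w - z)) ->
  {for z, continuous (divided_difference f z l)}.
Proof.
move=> fl; apply/(@cvg_normcP _ _ (nbhs z)) => e e0; apply/nbhs_normcP.
have e20 : 0 < e / 2 by rewrite divr_gt0.
have [d d0 fd] := fl _ e20; exists d => // w wd; rewrite /divided_difference eqxx.
have [_|wz] := eqVneq w z; first by rewrite subrr normc0.
have wz0 : w - z != 0 by rewrite subr_eq0.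
have -> : (f w - f z) * (w - z)^-1 - l = (f w - f z - l * (w - z)) * (w - z)^-1 by field.
rewrite normcM normcV; apply: (@le_lt_trans _ _ (e / 2)); last lra.
by rewrite ler_pdivrMr ?normc_gt0//; exact: fd.
Qed.

Lemma divided_difference_cdiff f z (l : R[i]) p : p != z -> cdiff f p ->
  cdiff (divided_difference f z l) p.
Proof.
move=> pz [k fk]; have pz0 : p - z != 0 by rewrite subr_eq0.
pose q := (f p - f z) * (p - z)^-1.
pose k' := (k - q) * (p - z)^-1; exists k' => e e0.
pose D := normc (p - z) / 2.
have D0 : 0 < D by rewrite divr_gt0// normc_gt0.
have [d d0 fd] := fk (e * D / 2) (divr_gt0 (mulr_gt0 e0 D0) (ltr0n _ 2)).
pose K := normc k' + 1; have K0 : 0 < K by rewrite ltr_wpDl ?normc_ge0.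
exists (Order.min d (Order.min D (e * D / 2 / K))).
  by rewrite !lt_min d0 D0 !divr_gt0// mulr_gt0.
move=> w; rewrite !lt_min => /andP[/fd wd /andP[wD wK]].
have Dwz : D <= normc (w - z).
  have := ler_normc_dist (p - z) (p - w).
  have -> : p - z - (p - w) = w - z by ring.
  by rewrite (normcB p w); move: wD; rewrite /D; lra.
have wz : w - z != 0 by rewrite -normc_gt0; exact: lt_le_trans Dwz.
rewrite /divided_difference -subr_eq0 (negbTE wz) (negbTE pz) -/q.
have -> : (f w - f z) * (w - z)^-1 - q - k' * (w - p) =
    (f w - f p - k * (w - p) - k' * (w - p) * (w - p)) * (w - z)^-1.
  by rewrite /k' /q; field; rewrite wz pz0.
rewrite normcM normcV ler_pdivrMr; last exact: lt_le_trans Dwz.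
apply: le_trans (ler_normcB _ _) _.
rewrite (normcM (k' * (w - p))) (normcM k').
have n0 := normc_ge0 (w - p).
have h1 : normc k' * normc (w - p) <= e * D / 2.
  move: wK; rewrite ltr_pdivlMr// mulrC => /ltW; apply: le_trans.
  by rewrite ler_wpM2r// lerDl.
apply: le_trans (lerD wd (ler_wpM2r n0 h1)) _.
rewrite -mulrDl -mulrA -mulrDr (_ : D / 2 + D / 2 = D); last by field.
by rewrite mulrAC ler_wpM2l// mulr_ge0// ltW.
Qed.

Context (z0 : R[i]^o) (s : R) (s0 : 0 < s).

Let x0 := complex.Re z0.
Let y0 := complex.Im z0.

Let fr : set R[i]^o := frame (x0 - s) (x0 + s) (y0 - s) (y0 + s).
Let sq : set R[i]^o := rectangle (x0 - s) (x0 + s) (y0 - s) (y0 + s).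
Let oint f := rect_integral f (x0 - s) (x0 + s) (y0 - s) (y0 + s).

Let xs : x0 - s <= x0 + s. Proof. by rewrite lerD2l ge0_cp ?ltW. Qed.
Let ys : y0 - s <= y0 + s. Proof. by rewrite lerD2l ge0_cp ?ltW. Qed.

Lemma frame_dist p : fr p -> s <= normc (p - z0).
Proof.
move=> H; suff [h|h] : s <= `|complex.Re (p - z0)| \/ s <= `|complex.Im (p - z0)|.
- exact: le_trans (normRe _).
- exact: le_trans (normIm _).
rewrite !raddfB /= -/x0 -/y0; move: H => [[_ [->|->]]|[_ [->|->]]].
- by right; rewrite addrAC subrr sub0r normrN ler_norm.
- by right; rewrite addrAC subrr add0r ler_norm.
- by left; rewrite addrAC subrr sub0r normrN ler_norm.
- by left; rewrite addrAC subrr add0r ler_norm.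
Qed.

Lemma frame_dist_near z p : normc (z - z0) <= s / 2 -> fr p -> s / 2 <= normc (p - z).
Proof.
move=> zs /frame_dist ps; have := ler_normc_dist (p - z0) (z - z0).
by rewrite opprB addrA subrK; lra.
Qed.

Lemma frame_neq z p : normc (z - z0) <= s / 2 -> fr p -> p - z != 0.
Proof.
move=> zs ps; rewrite -normc_gt0; apply: lt_le_trans (frame_dist_near zs ps).
by rewrite divr_gt0.
Qed.

Lemma square_dist p : sq p -> normc (p - z0) <= 2 * s.
Proof.
move=> [/andP[p1 p2] /andP[p3 p4]]; apply: le_trans (normc_ReIm _) _.
rewrite !raddfB /= -/x0 -/y0 mulr_natl mulr2n.
by apply: lerD; rewrite ler_norml; apply/andP; split; lra.
Qed.

Lemma normc_oint_le f M : continuous_on fr f -> (forall p, fr p -> normc (f p) <= M) ->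
  normc (oint f) <= 8 * s * M.
Proof.
move=> cf fM; apply: le_trans (normc_rect_integral_le xs ys cf fM) _.
by rewrite le_eqVlt; apply/orP; left; apply/eqP; ring.
Qed.

Definition cauchy_transform phi z : R[i]^o := oint (fun p => phi p * (p - z)^-1).

Lemma continuous_kernel z : normc (z - z0) <= s / 2 -> continuous_on fr (fun p => (p - z)^-1).
Proof.
move=> zs; apply: continuous_onV; first by move=> p; exact: frame_neq.
exact: (continuous_onB (@continuous_on_id _ _) (@continuous_on_cst _ _ z)).
Qed.

Lemma cauchy_transform_bound phi M z : continuous_on fr phi ->
  (forall p, fr p -> normc (phi p) <= M) -> normc (z - z0) <= s / 2 ->
  normc (cauchy_transform phi z) <= 16 * M.
Proof.
move=> cphi phiM zs.
apply: le_trans (normc_oint_le (M := M * (2 / s)) (continuous_onM cphi (continuous_kernel zs)) _) _.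
  move=> p ps; rewrite normcM normcV.
  apply: ler_pM; rewrite ?invr_ge0 ?normc_ge0//; first exact: phiM.
  rewrite -[2 / s]invf_div lef_pV2 ?posrE ?divr_gt0//; first exact: frame_dist_near.
  by rewrite normc_gt0; exact: frame_neq ps.
rewrite le_eqVlt; apply/orP; left; apply/eqP; field; exact: lt0r_neq0.
Qed.

(** Cauchy transforms are stable under divided differences: the difference
    quotient at [w] of the transform of [phi] is the transform of
    [phi / (id - w)]. *)
Lemma cauchy_transform_diff phi z w : continuous_on fr phi ->
  normc (z - z0) <= s / 2 -> normc (w - z0) <= s / 2 ->
  cauchy_transform phi z - cauchy_transform phi w =
  (z - w) * cauchy_transform (fun p => phi p * (p - w)^-1) z.
Proof.
move=> cphi zs ws; rewrite /cauchy_transform /oint.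
have cz := continuous_onM cphi (continuous_kernel zs).
have cw := continuous_onM cphi (continuous_kernel ws).
rewrite -(rect_integralB cz cw) -(rect_integralZ (z - w) (continuous_onM cw (continuous_kernel zs))).
apply: eq_rect_integral => p ps.
have [n1 n2] := (frame_neq zs ps, frame_neq ws ps).
by field; rewrite n1 n2.
Qed.

Lemma cauchy_transform_lipschitz phi M z w : continuous_on fr phi ->
  (forall p, fr p -> normc (phi p) <= M) ->
  normc (z - z0) <= s / 2 -> normc (w - z0) <= s / 2 ->
  normc (cauchy_transform phi z - cauchy_transform phi w) <= 32 * M / s * normc (z - w).
Proof.
move=> cphi phiM zs ws; rewrite cauchy_transform_diff// normcM mulrC.
apply: ler_wpM2r; first exact: normc_ge0.
apply: le_trans (cauchy_transform_bound (M := M * (2 / s))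
  (continuous_onM cphi (continuous_kernel ws)) _ zs) _.
  move=> p ps; rewrite normcM normcV.
  apply: ler_pM; rewrite ?invr_ge0 ?normc_ge0//; first exact: phiM.
  rewrite -[2 / s]invf_div lef_pV2 ?posrE ?divr_gt0//; first exact: frame_dist_near.
  by rewrite normc_gt0; exact: frame_neq ps.
rewrite le_eqVlt; apply/orP; left; apply/eqP; field; exact: lt0r_neq0.
Qed.

(** The integral of [1 / (p - z0)] is [2 * pi * 'i]; its imaginary part is at
    least [4] because each of the two pairs of sides contributes at least [2]. *)
Lemma winding_lower_bound : 4 <= normc (cauchy_transform (fun _ => 1) z0).
Proof.
have zs : normc (z0 - z0) <= s / 2 by rewrite subrr normc0 divr_ge0 ?ltW.
have ck := continuous_onM (@continuous_on_cst _ fr 1) (continuous_kernel zs).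
have [f1 f2 f3 f4] := frame_sides ck.
have zE : z0 = x0 +i* y0 by rewrite /x0 /y0; case: (z0).
have ds (t : R) : `|t| <= s -> s^-1 <= 2 * s / (t ^+ 2 + s ^+ 2) /\ 0 < t ^+ 2 + s ^+ 2.
  move=> ts; have t2 : t ^+ 2 <= s ^+ 2 by rewrite -real_normK ?num_real// lerXn2r ?nnegrE ?(ltW s0).
  have s2 : 0 < s ^+ 2 by rewrite exprn_gt0.
  have ts2 : 0 < t ^+ 2 + s ^+ 2 by rewrite ltr_wpDl ?sqr_ge0.
  split=> //; rewrite ler_pdivlMr// -ler_pdivlMl ?invr_gt0// invrK.
  by rewrite mulrCA -expr2 mulr_natl mulr2n lerD2r.
have dab (a t : R) : a - s <= t <= a + s -> `|t - a| <= s.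
  by move=> /andP[h1 h2]; rewrite ler_norml; apply/andP; split; lra.
have E1 t : x0 - s <= t <= x0 + s -> s^-1 <= complex.Im
    (1 * ((t +i* (y0 - s) : R[i]^o) - z0)^-1 - 1 * ((t +i* (y0 + s) : R[i]^o) - z0)^-1).
  move=> /dab /ds [h1 h2]; suff -> : 1 * ((t +i* (y0 - s) : R[i]^o) - z0)^-1 -
      1 * ((t +i* (y0 + s) : R[i]^o) - z0)^-1
     = 0 +i* (2 * s / ((t - x0) ^+ 2 + s ^+ 2)) by [].
  have -> : (t +i* (y0 - s) : R[i]^o) - z0 = (t - x0) +i* - s.
    by rewrite zE; apply/eqP; rewrite eq_complex /= addrAC subrr sub0r !eqxx.
  have -> : (t +i* (y0 + s) : R[i]^o) - z0 = (t - x0) +i* s.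
    by rewrite zE; apply/eqP; rewrite eq_complex /= addrAC subrr add0r !eqxx.
  rewrite !mul1r; apply/eqP; rewrite eq_complex /= sqrrN; apply/andP; split; apply/eqP.
    by rewrite subrr.
  by field; exact: lt0r_neq0.
have E2 t : y0 - s <= t <= y0 + s -> s^-1 <= complex.Re
    (1 * (((x0 + s) +i* t : R[i]^o) - z0)^-1 - 1 * (((x0 - s) +i* t : R[i]^o) - z0)^-1).
  move=> /dab /ds [h1 h2]; suff -> : 1 * (((x0 + s) +i* t : R[i]^o) - z0)^-1 -
      1 * (((x0 - s) +i* t : R[i]^o) - z0)^-1
     = (2 * s / ((t - y0) ^+ 2 + s ^+ 2))%:C by [].
  have -> : ((x0 + s) +i* t : R[i]^o) - z0 = s +i* (t - y0).
    by rewrite zE; apply/eqP; rewrite eq_complex /= addrAC subrr add0r !eqxx.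
  have -> : ((x0 - s) +i* t : R[i]^o) - z0 = - s +i* (t - y0).
    by rewrite zE; apply/eqP; rewrite eq_complex /= addrAC subrr sub0r !eqxx.
  rewrite !mul1r; apply/eqP; rewrite eq_complex /= sqrrN addrC [s ^+ 2 + _]addrC.
  apply/andP; split; apply/eqP; last by rewrite subrr.
  by field; exact: lt0r_neq0.
have I1 := Im_cintegral_ge xs (cont_itvB f1 f2) E1.
have I2 := Re_cintegral_ge ys (cont_itvB f4 f3) E2.
apply: le_trans (normIm _); apply: le_trans (ler_norm _).
have e2 (a : R) : s^-1 * (a + s - (a - s)) = 2 by field; exact: lt0r_neq0.
rewrite !e2 in I1 I2; apply: le_trans (_ : 2 + 2 <= _); first by rewrite -natrD.
apply: le_trans (lerD I1 I2) _.
by rewrite /cauchy_transform /oint /rect_integral raddfD /= mul0r mul1r add0r.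
Qed.

(** The divided difference of [f] at [z] has a vanishing contour integral, [z]
    being an exceptional point for Goursat's theorem.  The transform of [1]
    remains as a factor, kept away from zero near [z0] by
    [winding_lower_bound]. *)
Lemma cauchy_formula f z : (forall p, sq p -> cdiff f p) -> normc (z - z0) <= s / 2 ->
  cauchy_transform f z = f z * cauchy_transform (fun _ => 1) z.
Proof.
move=> df zs.
have cf : continuous_on sq f by move=> p /df; exact: cdiff_continuous.
have frs := frame_rectangle xs ys.
have [xz yz] : x0 - s < complex.Re z < x0 + s /\ y0 - s < complex.Im z < y0 + s.
  have := le_trans (normRe (z - z0)) zs; have := le_trans (normIm (z - z0)) zs.
  rewrite !raddfB /= -/x0 -/y0 !ler_norml => /andP[a1 a2] /andP[a3 a4].
  by split; exact: half_itv.
have zE : complex.Re z +i* complex.Im z = z by case: (z).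
have sz : sq z by split; apply/andP; split; apply: ltW; [case/andP: xz|case/andP: xz|case/andP: yz|case/andP: yz].
have [l fl] := df z sz.
have pzF p : sq p -> p <> z -> cdiff (divided_difference f z l) p.
  by move=> sp /eqP pz; apply: divided_difference_cdiff pz (df p sp).
have cF : continuous_on sq (divided_difference f z l).
  move=> p sp; have [->|/eqP pz] := eqVneq p z; first exact: divided_difference_continuous.
  by apply: cdiff_continuous; exact: pzF.
have F0 : oint (divided_difference f z l) = 0.
  by apply: (goursat_exceptional xz yz cF) => p sp; rewrite zE; exact: pzF.
have ck := continuous_onM (@continuous_on_cst _ fr 1) (continuous_kernel zs).
have cfk := continuous_onM (continuous_onS frs cf) (continuous_kernel zs).
apply/eqP; rewrite -subr_eq0 -F0 /cauchy_transform /oint.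
rewrite -(rect_integralZ (f z) ck).
rewrite -(rect_integralB cfk (continuous_onM (@continuous_on_cst _ fr (f z)) ck)).
apply/eqP/eq_rect_integral => p ps.
have := frame_neq zs ps; rewrite /divided_difference subr_eq0 => /negbTE ->.
by rewrite mul1r -mulrBl.
Qed.

End CauchyTransform.

(** Either all the iterated divided differences at [z0] of the Cauchy transform
    of [f - f z0] vanish at [z0], and then their geometric bounds force [f] to be
    constant near [z0]; or the first that does not vanish, divided by the
    transform of the constant [1], is the cofactor [g]. *)
Lemma local_factorization (R : realType) (f : R[i]^o -> R[i]^o) (z0 : R[i]^o) (d0 : R) :
  0 < d0 -> (forall p, normc (p - z0) < d0 -> cdiff f p) ->
  (exists2 d : R, 0 < d & forall z, normc (z - z0) < d -> f z = f z0) \/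
  exists (m : nat) (g : R[i]^o -> R[i]^o) (d L : R),
    [/\ (0 < m)%N, 0 < d, g z0 != 0,
      forall z, normc (z - z0) < d -> f z - f z0 = (z - z0) ^+ m * g z &
      forall z w, normc (z - z0) < d -> normc (w - z0) < d ->
        normc (g z - g w) <= L * normc (z - w)].
Proof.
move=> d00 df.
have z0d0 : normc (z0 - z0) < d0 by rewrite subrr normc0.
(* On the square of half-side [s] chosen below, [f - f z0] is at most [1] in
   modulus, which bounds all the transforms. *)
have [d1 d10 fd1] : exists2 d : R, 0 < d & forall w, normc (w - z0) < d -> normc (f w - f z0) < 1.
  by have /(@cvg_normcP _ _ (nbhs z0))/(_ 1 ltr01)/nbhs_normcP := cdiff_continuous (df z0 z0d0).
pose s := Order.min d0 d1 / 4.
have s0 : 0 < s by rewrite divr_gt0// lt_min d00.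
have [sd0 sd1] : 2 * s < d0 /\ 2 * s < d1.
  have : s * 4 <= Order.min d0 d1 by rewrite /s divfK.
  by rewrite le_min => /andP[h1 h2]; clear -s0 h1 h2; split; lra.
clearbody s.
set fr := frame (complex.Re z0 - s) (complex.Re z0 + s) (complex.Im z0 - s) (complex.Im z0 + s).
pose ft z : R[i]^o := f z - f z0.
pose phi k p : R[i]^o := ft p * ((p - z0)^-1) ^+ k.
pose T k := cauchy_transform z0 s (phi k).
pose W := cauchy_transform z0 s (fun _ => 1).
have sq_near p : rectangle (complex.Re z0 - s) (complex.Re z0 + s)
    (complex.Im z0 - s) (complex.Im z0 + s) p -> normc (p - z0) <= 2 * s.
  exact: square_dist.
have dft p : rectangle (complex.Re z0 - s) (complex.Re z0 + s)
    (complex.Im z0 - s) (complex.Im z0 + s) p -> cdiff ft p.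
  move=> /sq_near/le_lt_trans/(_ sd0)/df[l fl]; exists l => e /fl[d dd fd].
  by exists d => // w /fd; rewrite /ft opprB addrA subrK.
have fr_sq : fr `<=` rectangle (complex.Re z0 - s) (complex.Re z0 + s)
    (complex.Im z0 - s) (complex.Im z0 + s).
  by apply: frame_rectangle; rewrite lerD2l ge0_cp ?ltW.
have z0c : normc (z0 - z0) <= s / 2 by rewrite subrr normc0 divr_ge0 ?ltW.
have cphi k : continuous_on fr (phi k).
  elim: k => [|k IH].
    apply: continuous_onM; last exact: continuous_on_cst.
    by move=> p /fr_sq/dft; exact: cdiff_continuous.
  have -> : phi k.+1 = (fun p => phi k p * (p - z0)^-1).
    by apply/funext => p; rewrite /phi exprSr mulrA.
  exact: (continuous_onM IH (continuous_kernel s0 z0c)).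
have phi_le k p : fr p -> normc (phi k p) <= s^-1 ^+ k.
  move=> pf; rewrite /phi normcM normcX normcV -[leRHS]mul1r.
  apply: ler_pM; rewrite ?exprn_ge0 ?invr_ge0 ?normc_ge0//.
    by apply/ltW/fd1; apply: le_lt_trans sd1; apply: sq_near; exact: fr_sq.
  apply: lerXn2r; rewrite ?nnegrE ?invr_ge0 ?normc_ge0 ?(ltW s0)//.
  by rewrite lef_pV2 ?posrE//; [exact: frame_dist|apply: lt_le_trans s0 _; exact: frame_dist].
have c1 : continuous_on fr (fun _ => 1) by exact: continuous_on_cst.
have one_le p : fr p -> normc 1 <= 1 :> R by rewrite normc1.
have TS k z : normc (z - z0) <= s / 2 -> T k z - T k z0 = (z - z0) * T k.+1 z.
  have phiS : phi k.+1 = (fun p => phi k p * (p - z0)^-1).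
    by apply/funext => p; rewrite /phi exprSr mulrA.
  by move=> zc; rewrite /T phiS; exact: (cauchy_transform_diff s0 (cphi k) zc z0c).
have T0 z : normc (z - z0) <= s / 2 -> T 0%N z = ft z * W z.
  have phi0 : phi 0%N = ft by apply/funext => p; rewrite /phi expr0 mulr1.
  by move=> zc; rewrite /T phi0; exact: (cauchy_formula s0 dft zc).
have Texp k z : (forall j, (j < k)%N -> T j z0 = 0) -> normc (z - z0) <= s / 2 ->
    ft z * W z = (z - z0) ^+ k * T k z.
  move=> Tj zc; rewrite -T0//; elim: k Tj => [|k IH] Tj; first by rewrite expr0 mul1r.
  rewrite IH; last by move=> j jk; apply: Tj; exact: ltnW.
  by rewrite exprSr -mulrA -TS// Tj// subr0.
have zd z : normc (z - z0) < s / 16 -> normc (z - z0) <= s / 2 by move=> h; clear -s0 h; lra.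
(* [4 - 2]: the winding bound at the centre minus the variation of [W]. *)
have W2 z : normc (z - z0) < s / 16 -> 2 <= normc (W z).
  move=> zs; have := cauchy_transform_lipschitz s0 c1 one_le z0c (zd z zs).
  have := winding_lower_bound z0 s0; rewrite -/(W z0) -/(W z) mulr1 => h1 h2.
  have h3 : 32 / s * normc (z0 - z) <= 2.
    rewrite normcB mulrAC ler_pdivrMr//; clear -zs; lra.
  by have := ler_normc_dist (W z0) (W z); clear -h1 h2 h3; lra.
have W0 z : normc (z - z0) < s / 16 -> W z != 0.
  by move=> /W2 h; rewrite -normc_gt0; exact: lt_le_trans h.
have [TA|/existsNP[n /eqP nT]] := pselect (forall k, T k z0 = 0).
  left; exists (s / 16); first by rewrite divr_gt0.
  move=> z zs; apply/eqP; rewrite -subr_eq0 -/(ft z).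
  suff ftz : normc (ft z) <= 0 by rewrite (normc_le0 ftz).
  apply/ler_addgt0Pl => e e0; rewrite addr0.
  have [n ne] := exists_div_exp2_lt 8 e0.
  apply: le_trans (ltW ne); have zc := zd z zs.
  have : normc (ft z * W z) <= (s / 2) ^+ n * (16 * s^-1 ^+ n).
    rewrite (Texp n)// normcM normcX; apply: ler_pM; rewrite ?exprn_ge0 ?normc_ge0//.
      have s20 : 0 <= s / 2 by rewrite divr_ge0// ltW.
      by apply: lerXn2r; rewrite ?nnegrE ?normc_ge0.
    exact: (cauchy_transform_bound s0 (cphi n) (phi_le n) zc).
  have -> : (s / 2) ^+ n * (16 * s^-1 ^+ n) = 8 / 2 ^+ n * 2.
    have sn : s ^+ n != 0 by rewrite expf_neq0// lt0r_neq0.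
    have n2 : (2 : R) ^+ n != 0 by rewrite expf_neq0.
    move: sn n2; rewrite !exprMn !exprVn; move: (s ^+ n) ((2 : R) ^+ n) => a b a0 b0.
    by field; rewrite a0 b0.
  rewrite normcM => h; rewrite -(ler_pM2r (ltr0n R 2)); apply: le_trans h.
  by rewrite ler_wpM2l ?normc_ge0// W2.
right; have exT : exists n, T n z0 != 0 by exists n.
case: (ex_minnP exT) => m mT mmin.
have Tm j : (j < m)%N -> T j z0 = 0.
  by move=> jm; apply/eqP; apply: contraLR jm => /mmin; rewrite -leqNgt.
have m0 : (0 < m)%N.
  rewrite lt0n; apply: contra mT => /eqP ->; rewrite T0// /ft subrr mul0r//.
exists m, (fun z => T m z / W z), (s / 16).
pose M := s^-1 ^+ m.
exists (32 * M / s / 2 + 16 * M * (32 / s) / 4).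
have z0s : normc (z0 - z0) < s / 16 by rewrite subrr normc0 divr_gt0.
split=> //.
- by rewrite divr_gt0.
- by rewrite mulf_neq0// invr_eq0 W0.
- move=> z zs; rewrite mulrA -(Texp m z Tm (zd z zs)) mulfK//; exact: W0.
move=> z w zs ws.
have [Wz Ww] := (W0 z zs, W0 w ws).
have -> : T m z / W z - T m w / W w =
  (T m z - T m w) / W z + T m w * (W w - W z) / (W z * W w) by field; rewrite Wz Ww.
apply: le_trans (le_normcD _ _) _; rewrite [leRHS]mulrDl; apply: lerD.
  rewrite normcM normcV mulrAC; apply: ler_pM; rewrite ?invr_ge0 ?normc_ge0//.
    exact: (cauchy_transform_lipschitz s0 (cphi m) (phi_le m) (zd z zs) (zd w ws)).
  by rewrite lef_pV2 ?posrE// ?normc_gt0// W2.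
have h1 := cauchy_transform_bound s0 (cphi m) (phi_le m) (zd w ws).
have h2 := cauchy_transform_lipschitz s0 c1 one_le (zd z zs) (zd w ws).
rewrite mulr1 in h2.
have h3 : 4 <= normc (W z * W w).
  have -> : (4 : R) = 2 * 2 by rewrite -natrM.
  by rewrite normcM; apply: ler_pM; rewrite ?W2.
have -> : 16 * M * (32 / s) / 4 * normc (z - w) = (16 * M) * (32 / s * normc (z - w)) / 4 by ring.
rewrite normcM normcV; apply: ler_pM; rewrite ?invr_ge0 ?normc_ge0//.
  by rewrite normcM; apply: ler_pM; rewrite ?normc_ge0// normcB.
by rewrite lef_pV2 ?posrE//; apply: lt_le_trans h3.
Qed.

(** * The power map and grids *)

Section PowerMap.
Context {R : realType}.
Implicit Types (u v t : R[i]).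

Lemma normc_expB_le n u v (rho : R) : normc u <= rho -> normc v <= rho ->
  normc (u ^+ n.+1 - v ^+ n.+1) <= n.+1%:R * rho ^+ n * normc (u - v).
Proof.
move=> ur vr; have rho0 : 0 <= rho := le_trans (normc_ge0 u) ur.
elim: n => [|n IH]; first by rewrite !expr1 expr0 !mul1r.
have -> : u ^+ n.+2 - v ^+ n.+2 = u * (u ^+ n.+1 - v ^+ n.+1) + (u - v) * v ^+ n.+1.
  by rewrite !(exprS _ n.+1); ring.
apply: le_trans (le_normcD _ _) _; rewrite !normcM.
have h1 : normc u * normc (u ^+ n.+1 - v ^+ n.+1) <= rho * (n.+1%:R * rho ^+ n * normc (u - v)).
  by apply: ler_pM; rewrite ?normc_ge0.
have h2 : normc (u - v) * normc (v ^+ n.+1) <= normc (u - v) * rho ^+ n.+1.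
  by apply: ler_wpM2l; rewrite ?normc_ge0// normcX lerXn2r ?nnegrE ?normc_ge0.
apply: le_trans (lerD h1 h2) _; rewrite le_eqVlt; apply/orP; left; apply/eqP.
by rewrite -[n.+2%:R]natr1 exprS; ring.
Qed.

Lemma normc_exp_sub1_taylor n : exists2 K : R, 0 <= K & forall t, normc (t - 1) <= 1 ->
  normc (t ^+ n - 1 - n%:R * (t - 1)) <= K * normc (t - 1) ^+ 2.
Proof.
elim: n => [|n [K K0 HK]].
  by exists 0 => // t _; rewrite expr0 subrr mul0r subrr normc0 mul0r.
exists (2 * K + n%:R); first by rewrite addr_ge0 ?mulr_ge0.
move=> t t1; have t2 : normc t <= 2.
  rewrite -[t](subrK 1); apply: le_trans (le_normcD _ _) _.
  by rewrite normc1 -[2](@natrD R 1 1) lerD.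
have -> : t ^+ n.+1 - 1 - n.+1%:R * (t - 1) =
    t * (t ^+ n - 1 - n%:R * (t - 1)) + n%:R * (t - 1) ^+ 2.
  by rewrite exprS -natr1; ring.
apply: le_trans (le_normcD _ _) _; rewrite mulrDl; apply: lerD.
  by rewrite normcM -mulrA; apply: ler_pM; rewrite ?normc_ge0// HK.
rewrite normcM normcX ler_wpM2r ?sqr_ge0// ?exprn_ge0 ?normc_ge0//.
by rewrite -[X in normc X](rmorph_nat (real_complex R)) normc_real ger0_norm.
Qed.

(** The power map is bi-Lipschitz, with the expected constant, on sectors of
    small aperture: after rescaling by [u] this is the derivative at [1]. *)
Lemma normc_expB_ge n : exists2 eps : R, 0 < eps & forall u v,
  normc (v - u) <= eps * normc u ->
  normc u ^+ n * normc (v - u) <= 2 * normc (v ^+ n.+1 - u ^+ n.+1).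
Proof.
have [K K0 HK] := normc_exp_sub1_taylor n.+1.
have K1 : 0 < 2 * (K + 1) by rewrite mulr_gt0// ltr_wpDl.
exists (2 * (K + 1))^-1; first by rewrite invr_gt0.
move=> u v; have [->|u0] := eqVneq u 0.
  by rewrite normc0 mulr0 => /normc_le0 ->; rewrite normc0 mulr0 mulr_ge0 ?normc_ge0.
pose t := v / u; have vE : v = t * u by rewrite /t divfK.
have nu : 0 < normc u by rewrite normc_gt0.
have -> : v - u = (t - 1) * u by rewrite vE mulrBl mul1r.
have -> : v ^+ n.+1 - u ^+ n.+1 = (t ^+ n.+1 - 1) * u ^+ n.+1 by rewrite vE exprMn mulrBl mul1r.
rewrite !normcM ler_pM2r// => te; rewrite normcX mulrCA -exprSr mulrA.
rewrite ler_wpM2r ?exprn_ge0 ?normc_ge0//.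
set a := normc (t - 1) in te *; have a0 : 0 <= a := normc_ge0 _.
have t1 : a <= 1.
  by apply: le_trans te _; rewrite invf_le1//; lra.
have aK : K * a ^+ 2 <= a / 2.
  have : (2 * (K + 1)) * a <= 1 by rewrite mulrC -ler_pdivlMr// div1r.
  move=> h; rewrite expr2 mulrA; have h2 : K * a <= 1 / 2 by lra.
  by rewrite [a / 2]mulrC; apply: ler_wpM2r => //; rewrite -div1r.
have := HK t t1; rewrite -/a => h.
have := ler_normc_dist (n.+1%:R * (t - 1)) (n.+1%:R * (t - 1) - (t ^+ n.+1 - 1)).
have -> : n.+1%:R * (t - 1) - (n.+1%:R * (t - 1) - (t ^+ n.+1 - 1)) = t ^+ n.+1 - 1 by ring.
rewrite normcB normcM -[X in normc X * _](rmorph_nat (real_complex R)) normc_real ger0_norm// -/a.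
have : a <= n.+1%:R * a by rewrite ler_peMl// ler1n.
move: h aK; clear; lra.
Qed.

Lemma exprn_root (x : R) n : 0 <= x -> exists2 y : R, 0 <= y & y ^+ n.+1 = x.
Proof.
move=> x0; exists (x `^ n.+1%:R^-1); first exact: powR_ge0.
by rewrite -powR_mulrn ?powR_ge0// -powRrM mulVf// powRr1.
Qed.

(** The cells of a square grid of side [eps * sigma / 2].  By homogeneity the
    index type [T] can be fixed before the scale [sigma], which is what bounds
    the number of pieces uniformly in [local_cover]. *)
Lemma disc_cells (eps : R) : 0 < eps -> exists T : finType, inhabited T /\
  forall sigma, 0 < sigma -> exists K : R[i] -> T, forall x y,
    normc x <= 6 * sigma -> normc y <= 6 * sigma -> K x = K y ->
    normc (x - y) <= eps * sigma.
Proof.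
move=> e0; pose N := (Num.truncn (24 / eps)).+1.
exists ('I_N.+1 * 'I_N.+1)%type; split; first exact: (inhabits (ord0, ord0)).
move=> s s0; pose h := eps * s / 2; have h0 : 0 < h by rewrite divr_gt0 ?mulr_gt0.
pose k (x : R) := Num.truncn ((x + 6 * s) / h).
exists (fun z => (inord (k (complex.Re z)), inord (k (complex.Im z)))).
have kP (x : R) : `|x| <= 6 * s -> 0 <= (x + 6 * s) / h /\ (k x < N.+1)%N.
  rewrite ler_norml => /andP[x1 x2]; have p : 0 <= (x + 6 * s) / h.
    by apply: divr_ge0; [lra|exact: ltW].
  split=> //; rewrite /k truncn_lt_nat//.
  apply: (@le_lt_trans _ _ (24 / eps)); last first.
    by apply: lt_le_trans (truncnS_gt _) _; rewrite ler_nat /N.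
  rewrite ler_pdivrMr// /h (_ : 24 / eps * (eps * s / 2) = 12 * s); first lra.
  by field; exact: lt0r_neq0.
have kE (x y : R) : `|x| <= 6 * s -> `|y| <= 6 * s -> k x = k y -> `|x - y| <= h.
  have kx z : `|z| <= 6 * s -> (k z)%:R * h <= z + 6 * s /\ z + 6 * s < (k z)%:R * h + h.
    move=> /kP[z0 _]; have /andP[] := truncn_itv z0; rewrite -/(k z) => z1 z2.
    split; first by rewrite -ler_pdivlMr.
    by rewrite -{2}[h]mul1r -mulrDl natr1 -ltr_pdivrMr.
  move=> /kx[a1 a2] /kx[a3 a4] kxy; rewrite kxy in a1 a2.
  by rewrite ler_norml; apply/andP; split; lra.
have kI (x y : R) : `|x| <= 6 * s -> `|y| <= 6 * s ->
    inord (k x) = inord (k y) :> 'I_N.+1 -> k x = k y.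
  by move=> /kP[_ x0] /kP[_ y0] /(congr1 val); rewrite /= !inordK.
move=> x y xs ys [/kI e1 /kI e2].
have [xr xi] := (le_trans (normRe x) xs, le_trans (normIm x) xs).
have [yr yi] := (le_trans (normRe y) ys, le_trans (normIm y) ys).
apply: le_trans (normc_ReIm _) _; rewrite !raddfB /=.
apply: le_trans (lerD (kE _ _ xr yr (e1 xr yr)) (kE _ _ xi yi (e2 xi yi))) _.
by rewrite /h -splitr.
Qed.

End PowerMap.

(** * Distortion near a zero of finite order *)

Section LocalCover.
Context {R : realType} (f g : R[i]^o -> R[i]^o) (z0 : R[i]^o) (n : nat) (d L : R)
  (d0 : 0 < d) (gz0 : g z0 != 0)
  (fg : forall z, normc (z - z0) < d -> f z - f z0 = (z - z0) ^+ n.+1 * g z)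
  (gL : forall z w, normc (z - z0) < d -> normc (w - z0) < d ->
     normc (g z - g w) <= L * normc (z - w)).

Let b := normc (g z0).
Let b0 : 0 < b. Proof. by rewrite normc_gt0. Qed.

Let M := `|L| + 1.
Let M0 : 0 < M. Proof. by rewrite ltr_wpDl. Qed.

Let gM z w : normc (z - z0) < d -> normc (w - z0) < d -> normc (g z - g w) <= M * normc (z - w).
Proof.
move=> zd wd; apply: le_trans (gL zd wd) _; apply: ler_wpM2r; first exact: normc_ge0.
by rewrite (le_trans (ler_norm _))// lerDl.
Qed.

(** The radius inside which the variation of [g] is negligible against [g z0]. *)
Let delta := Order.min d (b / (8 * M)).
Let delta0 : 0 < delta. Proof. by rewrite lt_min d0 divr_gt0// mulr_gt0. Qed.
Let delta_d : delta <= d. Proof. by rewrite ge_min lexx. Qed.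
Let delta_M : M * delta <= b / 8.
Proof.
have : delta <= b / (8 * M) by rewrite ge_min lexx orbT.
by rewrite invfM mulrA ler_pdivlMr// mulrC.
Qed.

Let near z := normc (z - z0) < delta.

Let near_d z : near z -> normc (z - z0) < d.
Proof. by move=> zd; exact: lt_le_trans delta_d. Qed.

Let g_bounds z : near z -> b / 2 <= normc (g z) <= 2 * b.
Proof.
move=> zd; have z0d : normc (z0 - z0) < d by rewrite subrr normc0.
have h : normc (g z - g z0) <= b / 8.
  apply: le_trans (gM (near_d zd) z0d) _; apply: le_trans delta_M.
  by rewrite ler_pM2l// ltW.
have h1 := ler_normc_dist (g z0) (g z); rewrite (normcB (g z0)) in h1.
have h2 := le_normcD (g z - g z0) (g z0); rewrite subrK in h2.
by move: h h1 h2 b0; rewrite -/b => *; apply/andP; split; lra.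
Qed.

Let f_bounds z : near z ->
  b / 2 * normc (z - z0) ^+ n.+1 <= normc (f z - f z0) <= 2 * b * normc (z - z0) ^+ n.+1.
Proof.
move=> zd; rewrite (fg (near_d zd)) normcM normcX mulrC.
have /andP[h1 h2] := g_bounds zd.
by rewrite ![_ * normc (z - z0) ^+ n.+1]mulrC !ler_wpM2l ?exprn_ge0 ?normc_ge0.
Qed.

(** In [f x - f y] the differences of the powers and of the values of [g] are
    separated; the choice of [delta] makes the latter harmless. *)
Lemma factorized_lipschitz x y (rho : R) : near x -> near y ->
  normc (x - z0) <= rho -> normc (y - z0) <= rho ->
  normc (f x - f y) <= (2 * b * n.+1%:R + b) * rho ^+ n * normc (x - y).
Proof.
move=> xd yd xr yr; have rho0 : 0 <= rho := le_trans (normc_ge0 _) xr.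
have -> : f x - f y = ((x - z0) ^+ n.+1 - (y - z0) ^+ n.+1) * g x + (y - z0) ^+ n.+1 * (g x - g y).
  have -> : f x - f y = (f x - f z0) - (f y - f z0) by ring.
  by rewrite (fg (near_d xd)) (fg (near_d yd)); ring.
apply: le_trans (le_normcD _ _) _; rewrite !normcM.
have xy : x - z0 - (y - z0) = x - y by ring.
have h1 : normc ((x - z0) ^+ n.+1 - (y - z0) ^+ n.+1) * normc (g x) <=
    (n.+1%:R * rho ^+ n * normc (x - y)) * (2 * b).
  apply: ler_pM; rewrite ?normc_ge0//; last by case/andP: (g_bounds xd).
  by rewrite -xy; exact: normc_expB_le.
have h2 : normc ((y - z0) ^+ n.+1) * normc (g x - g y) <= (rho ^+ n * delta) * (M * normc (x - y)).
  apply: ler_pM; rewrite ?normc_ge0//; last exact: gM (near_d xd) (near_d yd).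
  rewrite normcX exprSr; apply: ler_pM; rewrite ?exprn_ge0 ?normc_ge0//; last exact: ltW.
  by apply: lerXn2r; rewrite ?nnegrE ?normc_ge0.
apply: le_trans (lerD h1 h2) _.
have -> : rho ^+ n * delta * (M * normc (x - y)) = (M * delta) * (rho ^+ n * normc (x - y)) by ring.
have P0 : 0 <= rho ^+ n * normc (x - y) by rewrite mulr_ge0 ?exprn_ge0 ?normc_ge0.
have h3 := ler_wpM2r P0 delta_M.
have h4 : b / 8 * (rho ^+ n * normc (x - y)) <= b * (rho ^+ n * normc (x - y)).
  by apply: ler_wpM2r => //; rewrite ler_pdivrMr// ler_peMr ?(ltW b0)// ler1n.
apply: le_trans (lerD (lexx _) (le_trans h3 h4)) _.
by rewrite le_eqVlt; apply/orP; left; apply/eqP; ring.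
Qed.

(** The same separation bounds [f y - f x] from below, since the power map is
    expanding on small sectors. *)
Lemma factorized_expansion : exists2 eps : R, 0 < eps & forall x y, near x -> near y ->
  normc (y - x) <= eps * normc (x - z0) ->
  b / 8 * normc (x - z0) ^+ n * normc (y - x) <= normc (f y - f x).
Proof.
have [eps e0 He] := @normc_expB_ge R n; exists eps => // x y xd yd xy.
have uv : y - z0 - (x - z0) = y - x by ring.
have := He (x - z0) (y - z0); rewrite uv => /(_ xy) h.
pose A := ((y - z0) ^+ n.+1 - (x - z0) ^+ n.+1) * g y.
pose B := (x - z0) ^+ n.+1 * (g x - g y).
have -> : f y - f x = A - B.
  have -> : f y - f x = (f y - f z0) - (f x - f z0) by ring.
  by rewrite (fg (near_d xd)) (fg (near_d yd)) /A /B; ring.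
apply: le_trans (ler_normc_dist _ _).
set P := normc (x - z0) ^+ n * normc (y - x).
have P0 : 0 <= P by rewrite mulr_ge0 ?exprn_ge0 ?normc_ge0.
have hA : P / 2 * (b / 2) <= normc A.
  rewrite normcM; apply: ler_pM; rewrite ?divr_ge0 ?(ltW b0)//.
    by rewrite ler_pdivrMr// mulrC.
  by case/andP: (g_bounds yd).
have hB : normc B <= P * (b / 8).
  rewrite /B normcM normcX exprSr.
  apply: le_trans (ler_wpM2l _ (gM (near_d xd) (near_d yd))) _.
    by rewrite mulr_ge0 ?exprn_ge0 ?normc_ge0.
  rewrite (normcB x y) (_ : _ * (M * _) = P * (M * normc (x - z0))); last by rewrite /P; ring.
  apply: ler_wpM2l => //; apply: le_trans delta_M.
  by rewrite ler_pM2l// ltW.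
by rewrite -mulrA -/P; move: hA hB; lra.
Qed.

(** This is how the identity theorem uses the factorization: away from [z0] the
    claim follows from the expansion estimate, at [z0] from [g z0 != 0]. *)
Lemma factorized_nowhere_constant : exists2 e : R, 0 < e &
  forall p, normc (p - z0) < e -> forall t, 0 < t -> exists2 q, normc (q - p) < t & f q <> f p.
Proof.
have [eps eps0 expand] := factorized_expansion; exists delta => // p pd t t0.
have addK (tau : R) : 0 < tau -> normc (p + tau%:C - p) = tau.
  by move=> tau0; rewrite addrC addrA addNr add0r normc_real gtr0_norm.
have [pz|pz] := eqVneq p z0.
  pose tau := Order.min t delta / 2.
  have m0 : 0 < Order.min t delta by rewrite lt_min t0.
  have tau0 : 0 < tau by rewrite divr_gt0.
  have : tau < Order.min t delta by rewrite ltr_pdivrMr// ltr_pMr// ltr1n.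
  rewrite lt_min => /andP[taut taud].
  exists (p + tau%:C); first by rewrite addK.
  have nearq : near (p + tau%:C) by rewrite /near -pz addK.
  have /andP[+ _] := f_bounds nearq; rewrite -pz addK// => h fq.
  move: h; rewrite fq subrr normc0 leNgt => /negP; apply.
  by rewrite mulr_gt0 ?divr_gt0 ?exprn_gt0.
have su : 0 < normc (p - z0) by rewrite normc_gt0 subr_eq0.
pose m := Order.min t (Order.min (eps * normc (p - z0)) (delta - normc (p - z0))).
have m0 : 0 < m by rewrite !lt_min t0 mulr_gt0//= subr_gt0.
pose tau := m / 2; have tau0 : 0 < tau by rewrite divr_gt0.
have : tau < m by rewrite ltr_pdivrMr// ltr_pMr// ltr1n.
rewrite !lt_min => /and3P[taut taue taud].
exists (p + tau%:C); first by rewrite addK.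
have nearq : near (p + tau%:C).
  rewrite /near (_ : p + tau%:C - z0 = (p - z0) + tau%:C); last by ring.
  apply: le_lt_trans (le_normcD _ _) _.
  by rewrite normc_real gtr0_norm//; move: taud; lra.
have := expand p (p + tau%:C) pd nearq; rewrite addK// => /(_ (ltW taue)) h fq.
move: h; rewrite fq subrr normc0 leNgt => /negP; apply.
by rewrite !mulr_gt0 ?divr_gt0 ?exprn_gt0.
Qed.

(** The heart of the matter: [rho] and [l] separately degenerate at a zero of
    [f - f z0] of order [n.+1], but their product does not, because the factor by
    which [f] expands a piece is comparable to its Lipschitz constant there.  The
    pieces are the fibres of [K] in the preimage of a disc of radius [r], and
    their number does not depend on the disc. *)
Lemma local_cover : exists (T : finType) (e C c : R), [/\ 0 < e, 0 < C, 0 < c &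
  forall p r, normc (p - z0) < e -> 0 < r < 2 ->
  exists K : R[i] -> T, forall k : T, exists rho l : R,
  [/\ c * r <= rho < 1, 0 < l, l * rho <= C * r &
    forall x y, normc (x - z0) < e -> normc (y - z0) < e ->
      normc (f x - f p) < r -> normc (f y - f p) < r -> K x = k -> K y = k ->
      normc (x - y) < rho /\ normc (f x - f y) <= l * normc (x - y)]].
Proof.
have [eps eps0 expand] := factorized_expansion.
have [T [[t0] cells]] := @disc_cells R (eps / 8) (divr_gt0 eps0 (ltr0n _ 8)).
pose A := 2 * b * n.+1%:R + b.
have A0 : 0 < A by rewrite ltr_wpDl// mulr_ge0// mulr_ge0// ltW.
pose e := Order.min delta (4 * 8 ^+ n)^-1.
have e0 : 0 < e by rewrite lt_min delta0 invr_gt0 mulr_gt0// exprn_gt0.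
have e8 : e <= (4 * 8 ^+ n)^-1 by rewrite ge_min lexx orbT.
have p8 : 1 <= (8 : R) ^+ n by rewrite exprn_ege1// ler1n.
have e4 : e <= 1 / 4.
  apply: le_trans e8 _; rewrite div1r lef_pV2 ?posrE ?mulr_gt0 ?exprn_gt0//.
  by rewrite ler_peMr.
have near_e z : normc (z - z0) < e -> near z.
  by move=> ze; apply: lt_le_trans ze _; rewrite ge_min lexx.
exists T, e, (54 * A / b + 16 * A * 48 ^+ n / b), 
  (Order.min (Order.min (18 / b) (1 / 2)) (Order.min (e / 2) (16 / b))); split=> //.
- by rewrite addr_gt0// ?divr_gt0 ?mulr_gt0 ?exprn_gt0.
- by rewrite !lt_min !divr_gt0.
move=> p r pe /andP[r0 r2].
set C1 := 54 * A / b; set C2 := 16 * A * 48 ^+ n / b; set c := Order.min _ _.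
have C10 : 0 < C1 by rewrite divr_gt0// mulr_gt0.
have C20 : 0 < C2 by rewrite divr_gt0// mulr_gt0 ?exprn_gt0// mulr_gt0.
have [[ca cb] [cd ce]] : (c <= 18 / b /\ c <= 1 / 2) /\ (c <= e / 2 /\ c <= 16 / b).
  have : c <= c by []; rewrite {2}/c !le_min => /andP[/andP[h1 h2] /andP[h3 h4]].
  by do !split.
have c0 : 0 <= c by rewrite ltW// !lt_min !divr_gt0.
have /andP[fp1 fp2] := f_bounds (near_e p pe).
set su := normc (p - z0) in fp1 fp2 pe.
have su0 : 0 <= su := normc_ge0 _.
have [hr|hr] := leP (b / 4 * su ^+ n.+1) r.
  (* The disc is close to [f z0]: one piece, of size [r] to the [1 / n.+1]. *)
  exists (fun _ => t0) => k.
  have r18 : 0 <= 18 * r / b by rewrite divr_ge0 ?mulr_ge0 ?ltW.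
  have [rho0 rho00 rhoE] := exprn_root n r18.
  pose rho := Order.min rho0 e.
  have rhoP : 0 < rho.
    rewrite lt_min e0 andbT lt_neqAle rho00 andbT; apply/eqP => rz.
    by move: rhoE; rewrite -rz expr0n /= => /esym/eqP; rewrite gt_eqF// divr_gt0// mulr_gt0.
  have rho_e : rho <= e by rewrite ge_min lexx orbT.
  exists (3 * rho), (A * rho ^+ n).
  have rhon : rho ^+ n.+1 <= 18 * r / b.
    by rewrite -rhoE lerXn2r ?nnegrE ?(ltW rhoP)// ge_min lexx.
  have c_rho : c * r <= rho.
    rewrite le_min; apply/andP; split.
      have [rho1|rho1] := leP rho0 1.
        apply: (@le_trans _ _ (18 * r / b)).
          by rewrite mulrAC ler_pM2r.
        by rewrite -rhoE exprS ler_piMr// exprn_ile1.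
      apply: le_trans (ltW rho1).
      apply: (@le_trans _ _ (1 / 2 * 2)); last by rewrite divfK.
      by apply: ler_pM => //; exact: ltW.
    apply: (@le_trans _ _ (e / 2 * 2)); last by rewrite divfK.
    by apply: ler_pM => //; exact: ltW.
  split.
  - by apply/andP; split; move: c_rho rho_e e4 rhoP; lra.
  - by rewrite mulr_gt0// exprn_gt0.
  - rewrite (_ : _ * (3 * rho) = 3 * A * rho ^+ n.+1); last by rewrite exprS; ring.
    apply: (@le_trans _ _ (3 * A * (18 * r / b))).
      by rewrite ler_pM2l// mulr_gt0.
    rewrite (_ : 3 * A * _ = C1 * r); last by rewrite /C1; ring.
    by rewrite ler_pM2r// lerDl ltW.
  have inS x : normc (x - z0) < e -> normc (f x - f p) < r -> normc (x - z0) <= rho.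
    move=> xe fx; rewrite le_min (ltW xe) andbT.
    rewrite -(@ler_pXn2r _ n.+1)// ?nnegrE ?normc_ge0// rhoE.
    have /andP[h1 _] := f_bounds (near_e x xe).
    have h2 := le_normcD (f x - f p) (f p - f z0).
    rewrite addrA subrK in h2.
    rewrite ler_pdivlMr//.
    by move: h1 h2 fx fp2 hr; set X := normc (x - z0) ^+ n.+1; lra.
  move=> x y xe ye fx fy _ _; have [xr yr] := (inS x xe fx, inS y ye fy).
  split; last exact: (factorized_lipschitz (near_e x xe) (near_e y ye) xr yr).
  rewrite (_ : x - y = (x - z0) - (y - z0)); last by ring.
  apply: le_lt_trans (ler_normcB _ _) _.
  by move: xr yr rhoP; lra.
(* The disc is far from [f z0]: its preimage lies in an annulus of radii
   comparable to [su], which is cut into cells small enough for [expand]. *)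
have sup : 0 < su.
  rewrite lt_neqAle su0 andbT; apply/eqP => sz.
  by move: hr; rewrite -sz expr0n /= mulr0 ltNge (ltW r0).
have [K HK] := cells su sup.
exists (fun z => K (z - z0)) => k.
pose rho := 16 * 8 ^+ n * r / (b * su ^+ n).
exists rho, (A * (6 * su) ^+ n).
have sun : 0 < su ^+ n by rewrite exprn_gt0.
have bsun : 0 < b * su ^+ n by rewrite mulr_gt0.
have pn0 k' : (0 : R) < k'.+1%:R ^+ n by rewrite exprn_gt0.
split.
- apply/andP; split.
    apply: (@le_trans _ _ (16 / b * r)); first by rewrite ler_pM2r.
    rewrite (_ : rho = 16 / b * r * (8 ^+ n / su ^+ n)); last first.
      by rewrite /rho; field; rewrite !lt0r_neq0.
    rewrite ler_pMr ?mulr_gt0 ?invr_gt0//.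
    rewrite ler_pdivlMr// mul1r; apply: le_trans p8.
    by apply: exprn_ile1 => //; move: pe e4; lra.
  rewrite /rho ltr_pdivrMr// mul1r.
  have h1 : 4 * 8 ^+ n * su <= 1.
    have n8 : (0 : R) < 4 * 8 ^+ n by rewrite mulr_gt0// exprn_gt0.
    have := le_trans (ltW pe) e8.
    by rewrite -(ler_pM2l n8) divff// lt0r_neq0.
  apply: (@lt_le_trans _ _ (16 * 8 ^+ n * (b / 4 * su ^+ n.+1))).
    by rewrite ltr_pM2l// mulr_gt0// exprn_gt0.
  rewrite (_ : _ * (b / 4 * _) = b * su ^+ n * (4 * 8 ^+ n * su)).
    by rewrite ler_piMr// ltW.
  by rewrite exprS; field.
- by rewrite mulr_gt0// exprn_gt0// mulr_gt0.
- rewrite (_ : _ * rho = C2 * r); first by rewrite ler_pM2r// lerDr ltW.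
  rewrite /rho /C2 (_ : 48 = 6 * 8); last by rewrite -natrM.
  rewrite !exprMn; move: (su ^+ n) sun (6 ^+ n) (8 ^+ n) => a a0 a6 a8.
  by field; rewrite !lt0r_neq0.
have inS x : normc (x - z0) < e -> normc (f x - f p) < r ->
    su / 8 <= normc (x - z0) /\ normc (x - z0) <= 6 * su.
  move=> xe fx; have /andP[h1 h2] := f_bounds (near_e x xe).
  have h3 := le_normcD (f x - f p) (f p - f z0); rewrite addrA subrK in h3.
  have h4 := ler_normcB (f x - f z0) (f x - f p).
  have fE : f x - f z0 - (f x - f p) = f p - f z0 by ring.
  rewrite fE in h4.
  set X := normc (x - z0) ^+ n.+1 in h1 h2.
  set U := su ^+ n.+1 in hr fp1 fp2.
  have U0 : 0 <= U by rewrite exprn_ge0.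
  have X0 : 0 <= X by rewrite exprn_ge0 ?normc_ge0.
  have XU : b * X <= b * (6 * U).
    by move: h1 h3 fx fp2 hr (mulr_ge0 (ltW b0) U0); lra.
  have UX : b * U <= b * (8 * X).
    by move: fp1 h4 fx h2 hr; lra.
  rewrite ler_pM2l// in XU; rewrite ler_pM2l// in UX.
  split.
    rewrite -(@ler_pXn2r _ n.+1)// ?nnegrE ?normc_ge0 ?divr_ge0//.
    rewrite expr_div_n ler_pdivrMr ?exprn_gt0//; apply: le_trans UX _.
    rewrite [leLHS]mulrC -/X; apply: ler_wpM2l => //.
    by rewrite exprS ler_pMr.
  rewrite -(@ler_pXn2r _ n.+1)// ?nnegrE ?normc_ge0 ?mulr_ge0//.
  apply: le_trans XU _; rewrite exprMn exprS ler_wpM2r// ler_peMr// exprn_ege1//.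
  by rewrite ler1n.
move=> x y xe ye fx fy xk yk.
have [x1 x2] := inS x xe fx; have [y1 y2] := inS y ye fy.
have xy := HK _ _ x2 y2 (etrans xk (esym yk)).
have uv : x - z0 - (y - z0) = x - y by ring.
rewrite uv in xy.
split; last exact: (factorized_lipschitz (near_e x xe) (near_e y ye) x2 y2).
have epsx : normc (y - x) <= eps * normc (x - z0).
  rewrite normcB; apply: le_trans xy _; rewrite -mulrA mulrC [_^-1 * _]mulrC -[leRHS]mulrC.
  by rewrite ler_pM2r.
have h1 := expand x y (near_e x xe) (near_e y ye) epsx.
have h2 : normc (f y - f x) < 2 * r.
  have -> : f y - f x = (f y - f p) - (f x - f p) by ring.
  by apply: le_lt_trans (ler_normcB _ _) _; rewrite mulr_natl mulr2n ltrD.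
have h3 : b / 8 * (su / 8) ^+ n * normc (y - x) < 2 * r.
  apply: le_lt_trans (le_lt_trans h1 h2).
  apply: ler_wpM2r; first exact: normc_ge0.
  rewrite ler_pM2l ?divr_gt0//.
  by apply: lerXn2r; rewrite ?nnegrE ?normc_ge0 ?divr_ge0.
rewrite normcB /rho ltr_pdivlMr//.
rewrite expr_div_n in h3.
have q8 : (0 : R) < 8 ^+ n by rewrite exprn_gt0.
rewrite -(ltr_pM2l (ltr0n R 8)) -(ltr_pM2l q8) in h3 .
apply: le_lt_trans (lt_le_trans h3 _); rewrite le_eqVlt; apply/orP; left; apply/eqP.
  by field; rewrite lt0r_neq0.
by ring.
Qed.

End LocalCover.

(** * The identity theorem *)

Section Identity.
Context {R : realType}.
Implicit Types (z p q : R[i]^o).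

Lemma derivable_cdiff (h : R[i]^o -> R[i]^o) z : derivable h z 1 -> cdiff h z.
Proof.
move=> /cvg_ex[l hl]; exists l => e e0.
move: hl => /(@cvg_normcP _ _ _ (dnbhs_filter 0))/(_ e e0).
rewrite /dnbhs /within /=.
move=> /nbhs_normcP[d d0 hd]; exists d => // w wd.
have [->|wz] := eqVneq w z; first by rewrite !subrr mulr0 subr0 normc0 mulr0.
have wz0 : w - z != 0 by rewrite subr_eq0.
have := hd (w - z); rewrite subr0 => /(_ wd wz0).
rewrite /shift /= (_ : (w - z) *: 1 + z = w); last by rewrite -[_ *: _]/(_ * _) mulr1 subrK.
move=> hw.
have -> : h w - h z - l * (w - z) = ((w - z)^-1 * (h w - h z) - l) * (w - z) by field.
by rewrite normcM ler_wpM2r ?normc_ge0// ltW.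
Qed.

Lemma open_normcP (A : set R[i]^o) : open A <->
  forall z, A z -> exists2 d : R, 0 < d & forall w, normc (w - z) < d -> A w.
Proof.
rewrite openE; split=> h z /h; by [move/nbhs_normcP|move=> ?; apply/nbhs_normcP].
Qed.

Lemma holomorphic_dichotomy (Omega : set R[i]^o) (h : R[i]^o -> R[i]^o) z0 :
  open Omega -> holomorphic_on Omega h -> Omega z0 ->
  (exists2 d : R, 0 < d & forall z, normc (z - z0) < d -> h z = h z0) \/
  exists (n : nat) (g : R[i]^o -> R[i]^o) (d L : R),
    [/\ 0 < d, g z0 != 0,
      forall z, normc (z - z0) < d -> h z - h z0 = (z - z0) ^+ n.+1 * g z &
      forall z w, normc (z - z0) < d -> normc (w - z0) < d ->
        normc (g z - g w) <= L * normc (z - w)].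
Proof.
move=> /open_normcP oO hO Oz0; have [d d0 dO] := oO _ Oz0.
have [|[m [g [e [L [m0 e0 gz hg gL]]]]]] := local_factorization d0 (fun p pd => derivable_cdiff (hO p (dO p pd))).
  by left.
by right; exists m.-1, g, e, L; split=> //; rewrite prednK.
Qed.

(** The points near which [h] is constantly [h z1] form a relatively clopen
    subset of [Omega]: at a point outside it, [h] is either locally another
    constant, or factorizes and is then constant near no nearby point. *)
Lemma nowhere_locally_constant (Omega : set R[i]^o) (h : R[i]^o -> R[i]^o) z1 :
  complex_domain Omega -> holomorphic_on Omega h -> nonconstant_on Omega h -> Omega z1 ->
  ~ exists2 d : R, 0 < d & forall z, normc (z - z1) < d -> h z = h z1.
Proof.
move=> [_ oO cO] hO [a [b [Oa Ob hab]]] Oz1 [d1 d10 hd1].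
pose U : set R[i]^o := [set z | exists2 d : R, 0 < d & forall w, normc (w - z) < d -> h w = h z1].
have Uh z : U z -> h z = h z1 by move=> [d d0]; apply; rewrite subrr normc0.
have oU : open U.
  apply/open_normcP => z [d d0 hd]; exists (d / 2); first by rewrite divr_gt0.
  move=> w wz; exists (d / 2); first by rewrite divr_gt0.
  move=> v vw; apply: hd; rewrite (_ : v - z = (v - w) + (w - z)); last by ring.
  by apply: le_lt_trans (le_normcD _ _) _; move: wz vw; lra.
have oV : open (Omega `&` ~` U).
  apply/open_normcP => z [Oz nUz].
  have [d d0 dO] := (open_normcP _).1 oO z Oz.
  suff [e e0 eU] : exists2 e : R, 0 < e & forall w, normc (w - z) < e -> ~ U w.
    exists (Order.min d e); first by rewrite lt_min d0.
    by move=> w; rewrite lt_min => /andP[/dO Ow /eU nUw].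
  have [[e e0 hz]|[n [g [e [L [e0 gz hg gL]]]]]] := holomorphic_dichotomy oO hO Oz.
    exists e => // w /hz hw /Uh hw1; apply: nUz.
    by exists e => // v /hz ->; rewrite -hw1 hw.
  have [e' e'0 ne] := factorized_nowhere_constant e0 gz hg gL.
  exists e' => // w /ne nw [t t0 ht]; have [q qw] := nw t t0; apply.
  by rewrite (ht q qw) ht// subrr normc0.
have UO : Omega `&` U = Omega.
  apply: cO; first by exists z1; split=> //; exists d1.
    by exists U.
  exists (~` (Omega `&` ~` U)); first exact: open_closedC.
  apply/seteqP; split=> z [Oz Uz]; split=> //; first by case.
  by apply: contrapT => nU; apply: Uz.
have hc z : Omega z -> h z = h z1 by rewrite -UO => -[_ /Uh].
by apply: hab; rewrite (hc a Oa) (hc b Ob).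
Qed.

Lemma holomorphic_local_cover (Omega : set R[i]^o) (h : R[i]^o -> R[i]^o) z0 :
  complex_domain Omega -> holomorphic_on Omega h -> nonconstant_on Omega h -> Omega z0 ->
  exists (T : finType) (e C c : R), [/\ 0 < e, 0 < C, 0 < c &
  forall p r, normc (p - z0) < e -> 0 < r < 2 ->
  exists K : R[i] -> T, forall k : T, exists rho l : R,
  [/\ c * r <= rho < 1, 0 < l, l * rho <= C * r &
    forall x y, normc (x - z0) < e -> normc (y - z0) < e ->
      normc (h x - h p) < r -> normc (h y - h p) < r -> K x = k -> K y = k ->
      normc (x - y) < rho /\ normc (h x - h y) <= l * normc (x - y)]].
Proof.
move=> dO hO nO Oz0; have := nowhere_locally_constant dO hO nO Oz0.
case: (dO) => _ oO _.
have [lc /(_ lc)[]|[n [g [d [L [d0 gz hg gL]]]]] _] := holomorphic_dichotomy oO hO Oz0.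
exact: (local_cover d0 gz hg gL).
Qed.

End Identity.

(** * Coverings *)

Section Coverings.
Context {R : realType}.
Implicit Types (A B : set R[i]^o) (r x : R).

Lemma diameter_le A r :
  (diameter A <= r%:E)%E <-> forall z w, A z -> A w -> normc (z - w) <= r.
Proof.
split=> [dA z w Az Aw|Ar].
  by rewrite -lee_fin; apply: le_trans dA; apply: ereal_sup_ubound; exists z => //; exists w.
by apply: ge_ereal_sup => _ [z Az [w Aw <-]]; rewrite lee_fin; exact: Ar.
Qed.

Lemma coverable_fintype (J : finType) (U : J -> set R[i]^o) A r :
  (forall j, (diameter (U j) <= r%:E)%E) -> A `<=` \bigcup_j U j -> coverable A r #|J|.
Proof.
move=> dU AU; exists (fun i => U (enum_val i)); split=> [i|z /AU[j _ Uj]]; first exact: dU.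
by exists (enum_rank j) => //; rewrite enum_rankK.
Qed.

(** Working with the existence of a cover by at most [x] sets, rather than with
    the infimum, costs an additive [1] (see [covering_number_covers]), which a
    bound of the form [C * (rad / r) `^ alpha] absorbs. *)
Definition covers A r x := exists2 n : nat, n%:R <= x & coverable A r n.

Lemma covers_number A r x : covers A r x -> (covering_number A r <= x%:E)%E.
Proof.
move=> [n nx An]; apply: (@le_trans _ _ (n%:R%:E)); last by rewrite lee_fin.
by apply: ereal_inf_lbound; exists n.
Qed.

Lemma covering_number_covers A r x : (covering_number A r <= x%:E)%E -> covers A r (x + 1).
Proof.
move=> Ax; have : (covering_number A r < (x + 1)%:E)%E.
  by apply: le_lt_trans Ax _; rewrite lte_fin ltrDl.
by move=> /ereal_inf_lt[_ [n An <-]]; rewrite lte_fin => /ltW nx; exists n.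
Qed.

Lemma covers_le A r x y : x <= y -> covers A r x -> covers A r y.
Proof. by move=> xy [n nx An]; exists n => //; exact: le_trans xy. Qed.

Lemma coversS A B r x : A `<=` B -> covers B r x -> covers A r x.
Proof.
by move=> AB [n nx [U [dU BU]]]; exists n => //; exists U; split=> //; exact: subset_trans BU.
Qed.

Lemma covers0 A r x : 0 <= x -> A `<=` set0 -> covers A r x.
Proof.
move=> x0 A0; exists 0%N => //; exists (fun _ => set0); split; first by case.
by move=> z /A0.
Qed.

Lemma covers_bigcup (T : finType) (A : T -> set R[i]^o) r (x : T -> R) :
  (forall k, covers (A k) r (x k)) -> covers (\bigcup_k A k) r (\sum_k x k).
Proof.
move=> Ax; have /choice[n nP] : forall k, exists n : nat, n%:R <= x k /\ coverable (A k) r n.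
  by move=> k; have [n] := Ax k; exists n.
have cov k := (nP k).2.
exists #|{: {k : T & 'I_(n k)}}|.
  rewrite card_tagged sumnE big_map big_enum /= natr_sum; apply: ler_sum => k _.
  by rewrite card_ord; case: (nP k).
pose U k := projT1 (cid (cov k)).
have UP k : (forall i, (diameter (U k i) <= r%:E)%E) /\ A k `<=` \bigcup_i U k i.
  exact: (projT2 (cid (cov k))).
apply: (@coverable_fintype _ (fun j => U (tag j) (tagged j))) => [[k i] /=|z [k _ /((UP k).2)[i _ Ui]]].
  exact: (UP k).1.
by exists (Tagged (fun k => 'I_(n k)) i).
Qed.

Lemma covers_image (f : R[i]^o -> R[i]^o) A r' r x l : 0 < l -> l * r' <= r ->
  (forall z w, A z -> A w -> normc (f z - f w) <= l * normc (z - w)) ->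
  covers A r' x -> covers (f @` A) r x.
Proof.
move=> l0 lr fl [n nx [U [dU AU]]]; exists n => //.
exists (fun i => f @` (U i `&` A)); split=> [i|_ [z Az <-]].
  apply/diameter_le => _ _ [z [Uz Az] <-] [w [Uw Aw] <-].
  apply: le_trans (fl z w Az Aw) (le_trans _ lr); rewrite ler_pM2l//.
  by have /diameter_le := dU i; apply.
by have [i _ Ui] := AU z Az; exists i => //; exists z.
Qed.

(** The scale [min (r / l) (rho `^ theta^-1)] is admissible for [E] and at
    distortion [l]; the ratio of [rho] to it stays below a constant times
    [rad / r] because [rho >= c * rad] and [r <= rad `^ theta^-1]. *)
Lemma covers_lipschitz_piece (E : set R[i]^o) (theta alpha C0 C c : R) :
  0 < theta < 1 -> 0 < alpha -> 0 < C0 -> 0 < C -> 0 < c ->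
  (forall (z : R[i]^o) (rad r : R), E z ->
      0 < r <= rad `^ theta^-1 -> rad `^ theta^-1 < rad < 1 ->
      (covering_number (ball z rad%:C `&` E) r <= (C0 * (rad / r) `^ alpha)%:E)%E) ->
  exists2 D : R, 0 <= D &
    forall (f : R[i]^o -> R[i]^o) (S : set R[i]^o) (rad r rho l : R), S `<=` E ->
      0 < r <= rad `^ theta^-1 -> rad `^ theta^-1 < rad < 1 ->
      c * rad <= rho < 1 -> 0 < l -> l * rho <= C * rad ->
      (forall x y : R[i]^o, S x -> S y -> normc (x - y) < rho /\ normc (f x - f y) <= l * normc (x - y)) ->
      covers (f @` S) r (D * (rad / r) `^ alpha).
Proof.
move=> /andP[t0 t1] a0 C00 C_0 c0 bound.
set tau := theta^-1 in bound *.
have tau1 : 0 < tau - 1 by rewrite subr_gt0 /tau invf_gt1.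
have tau0 : 0 < tau by rewrite invr_gt0.
pose D1 := C + (c `^ (tau - 1))^-1.
have ct0 : 0 < c `^ (tau - 1) by rewrite powR_gt0.
have D10 : 0 < D1 by rewrite addr_gt0// invr_gt0.
exists (C0 * D1 `^ alpha + 1); first by rewrite addr_ge0 ?mulr_ge0 ?powR_ge0 ?(ltW C00).
move=> f S rad r rho l SE /andP[r0 rrad] /andP[radt rad1] /andP[crho rho1] l0 lrho fS.
have rad0 : 0 < rad by apply: le_lt_trans (powR_ge0 _ _) radt.
have rho0 : 0 < rho by apply: lt_le_trans crho; rewrite mulr_gt0.
have rr1 : 1 <= rad / r by rewrite ler_pdivlMr// mul1r; exact: le_trans rrad (ltW radt).
have P1 : 1 <= (rad / r) `^ alpha.
  by rewrite -(powRr0 (rad / r)); apply: ler_powR => //; exact: ltW.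
have tauE (a : R) : 0 < a -> a `^ tau = a * a `^ (tau - 1).
  by move=> a0'; rewrite mulr_powRB1// ltW.
have rhot : rho `^ tau < rho.
  rewrite tauE// -[ltRHS]mulr1 ltr_pM2l//.
  have one : 1 `^ (tau - 1) = 1 :> R by rewrite powR1.
  by rewrite -[ltRHS]one; apply: gt0_ltr_powR; rewrite ?nnegrE ?(ltW rho0).
pose r' := Order.min (r / l) (rho `^ tau).
have r'0 : 0 < r' by rewrite lt_min divr_gt0// powR_gt0.
have r'tau : r' <= rho `^ tau by rewrite ge_min lexx orbT.
have lr' : l * r' <= r.
  by rewrite mulrC -ler_pdivlMr// ge_min lexx.
have ratio : rho / r' <= D1 * (rad / r).
  rewrite ler_pdivrMr//.
  have q0 : 0 < D1 * (rad / r) by rewrite mulr_gt0// divr_gt0.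
  rewrite mulrC -ler_pdivrMr// le_min; apply/andP; split.
    rewrite ler_pdivrMr// mulrAC ler_pdivlMr// mulrC.
    apply: (le_trans lrho); rewrite (_ : r * _ = D1 * rad); last by field; exact: lt0r_neq0.
    by rewrite ler_pM2r// lerDl invr_ge0 ltW.
  rewrite tauE// ler_pdivrMr// -[leLHS]mulr1 -mulrA ler_pM2l//.
  have h1 : c `^ (tau - 1) * rad `^ (tau - 1) <= rho `^ (tau - 1).
    rewrite -powRM ?(ltW c0) ?(ltW rad0)//; apply: ge0_ler_powR => //; rewrite ?nnegrE ?(ltW rho0) ?(ltW tau1)//.
    by rewrite mulr_ge0 ?ltW.
  have h2 : 1 <= rad `^ (tau - 1) * (rad / r).
    by rewrite mulrA ler_pdivlMr// mul1r mulrC -tauE.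
  rewrite mulrCA mulrA; apply: (@le_trans _ _ (D1 * c `^ (tau - 1))).
    by rewrite /D1 mulrDl mulVf ?lt0r_neq0// lerDr mulr_ge0 ?ltW.
  rewrite -!mulrA ler_pM2l//.
  apply: (@le_trans _ _ (c `^ (tau - 1) * (rad `^ (tau - 1) * (rad / r)))).
    by rewrite ler_peMr// ltW.
  by rewrite mulrA ler_wpM2r// divr_ge0 ?ltW.
have [[q Sq]|S0] := pselect (exists q, S q); last first.
  apply: covers0; first by rewrite mulr_ge0 ?powR_ge0// addr_ge0// mulr_ge0 ?powR_ge0 ?ltW.
  by move=> y [x Sx _]; apply: S0; exists x.
have Ebound : (covering_number (ball q rho%:C `&` E) r' <= (C0 * (rho / r') `^ alpha)%:E)%E.
  by apply: bound; rewrite ?r'0 ?rhot//; exact: SE.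
have fL (x y : R[i]^o) : S x -> S y -> normc (f x - f y) <= l * normc (x - y).
  by move=> Sx Sy; exact: (fS x y Sx Sy).2.
apply: (covers_image l0 lr' fL).
apply: (coversS (B := ball q rho%:C `&` E)).
  by move=> x Sx; split; [rewrite ball_normcE; exact: (fS q x Sq Sx).1|exact: SE].
apply: covers_le (covering_number_covers Ebound).
rewrite mulrDl mul1r; apply: lerD => //.
rewrite -mulrA ler_pM2l// -powRM ?(ltW D10) ?divr_ge0 ?(ltW rad0) ?(ltW r0)//.
apply: (ge0_ler_powR (ltW a0) _ _ ratio); rewrite nnegrE.
  by rewrite divr_ge0 ?(ltW rho0) ?(ltW r'0).
by rewrite mulr_ge0 ?divr_ge0 ?(ltW D10) ?(ltW rad0) ?(ltW r0).
Qed.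

End Coverings.

(** * The Assouad spectrum of the image *)

Section LocalBound.
Context {R : realType} (Omega : set R[i]^o) (h : R[i]^o -> R[i]^o) (E : set R[i]^o)
  (theta alpha : R).

(** The disc [ball w rad] need not be centred in the image of the part of [E]
    near [z0]; recentring it at a point of that image doubles its radius. *)
Lemma local_covering_bound (z0 : R[i]^o) :
  complex_domain Omega -> holomorphic_on Omega h -> nonconstant_on Omega h -> Omega z0 ->
  0 < theta < 1 -> 0 < alpha -> assouad_bound theta E alpha ->
  exists e D : R, [/\ 0 < e, 0 <= D & forall (w : R[i]^o) (rad r : R),
    0 < r <= rad `^ theta^-1 -> rad `^ theta^-1 < rad < 1 ->
    covers (h @` [set q | [/\ E q, normc (q - z0) < e & normc (h q - w) < rad]]) r
      (D * (rad / r) `^ alpha)].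
Proof.
move=> dO hO nO Oz0 th01 a0 [C0 C00 bound].
have [T [e [C [c [e0 C_0 c0 cover]]]]] := holomorphic_local_cover dO hO nO Oz0.
have [D D0 piece] := covers_lipschitz_piece th01 a0 C00 (mulr_gt0 C_0 (ltr0n R 2))
  (mulr_gt0 c0 (ltr0n R 2)) bound.
exists e, (#|T|%:R * D); split=> //; first by rewrite mulr_ge0.
move=> w rad r r_rad rad_1.
have rad0 : 0 < rad by case/andP: rad_1 => + _; apply: le_lt_trans; exact: powR_ge0.
have [[p [Ep pe pw]]|none] :=
    pselect (exists p, [/\ E p, normc (p - z0) < e & normc (h p - w) < rad]); last first.
  apply: covers0; first by rewrite !mulr_ge0 ?powR_ge0.
  by move=> y [q qP _]; apply: none; exists q.
have rad2 : 0 < rad * 2 < 2.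
  by apply/andP; split; case/andP: rad_1 => _; move: rad0; lra.
have [K HK] := cover p (rad * 2) pe rad2.
pose S k : set R[i]^o := [set q | [/\ E q, normc (q - z0) < e, normc (h q - w) < rad & K q = k]].
apply: (coversS (B := \bigcup_k (h @` S k))).
  by move=> _ [q [Eq qe qw] <-]; exists (K q) => //; exists q.
apply: (covers_le (x := \sum_(k : T) D * (rad / r) `^ alpha)).
  by rewrite sumr_const -mulrA mulr_natl.
apply: covers_bigcup => k; have [rho [l [rhoP l0 lrho HS]]] := HK k.
apply: (piece h (S k) rad r rho l) => //.
- by move=> q [].
- by rewrite -mulrA [2 * rad]mulrC.
- by rewrite -mulrA [2 * rad]mulrC.
have close q : S k q -> normc (h q - h p) < rad * 2.
  move=> [_ _ qw _]; rewrite (_ : h q - h p = (h q - w) - (h p - w)); last by ring.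
  apply: le_lt_trans (ler_normcB _ _) _.
  by rewrite mulr_natr mulr2n ltrD.
move=> x y Sx Sy; have [_ xe _ xk] := Sx; have [_ ye _ yk] := Sy.
by apply: HS => //; exact: close.
Qed.

(** Finitely many of the discs of [local_covering_bound] cover [E], and their
    constants add up; the exponent is unchanged. *)
Lemma assouad_bound_image :
  complex_domain Omega -> holomorphic_on Omega h -> nonconstant_on Omega h ->
  compact E -> E `<=` Omega -> 0 < theta < 1 -> 0 < alpha ->
  assouad_bound theta E alpha -> assouad_bound theta (h @` E) alpha.
Proof.
move=> dO hO nO cE EO th01 a0 bound.
have /choice[eD eDP] : forall z0 : R[i]^o, exists eD : R * R, E z0 -> [/\ 0 < eD.1, 0 <= eD.2 &
    forall (w : R[i]^o) (rad r : R),
    0 < r <= rad `^ theta^-1 -> rad `^ theta^-1 < rad < 1 ->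
    covers (h @` [set q | [/\ E q, normc (q - z0) < eD.1 & normc (h q - w) < rad]]) r
      (eD.2 * (rad / r) `^ alpha)].
  move=> z0; have [Ez0|] := pselect (E z0); last by exists (0, 0).
  have [e [D H]] := local_covering_bound dO hO nO (EO z0 Ez0) th01 a0 bound.
  by exists (e, D).
have [Z ZE Zcov] : finite_subset_cover E (fun z0 : R[i]^o => [set q | normc (q - z0) < (eD z0).1]) E.
  move: cE; rewrite compact_cover; apply.
    move=> z0 _; apply/open_normcP => q qz.
    exists ((eD z0).1 - normc (q - z0)); first by rewrite subr_gt0.
    move=> v vq; rewrite /= (_ : v - z0 = (v - q) + (q - z0)); last by ring.
    by apply: le_lt_trans (le_normcD _ _) _; move: vq; rewrite ltrBrDr.
  by move=> z Ez; exists z => //=; rewrite subrr normc0; case: (eDP z Ez).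
have EZ (k : Z) : E (val k) by apply/set_mem/ZE/valP.
pose D := \sum_(k : Z) (eD (val k)).2 + 1.
exists D; first by rewrite /D ltr_wpDl// sumr_ge0// => k _; case: (eDP _ (EZ k)).
move=> w rad r _ r_rad rad_1; apply: covers_number.
apply: (covers_le (x := \sum_(k : Z) (eD (val k)).2 * (rad / r) `^ alpha)).
  by rewrite -mulr_suml /D ler_wpM2r ?powR_ge0// lerDl.
apply: (coversS (B := \bigcup_(k : Z) (h @` [set q | [/\ E q, normc (q - val k) < (eD (val k)).1 &
    normc (h q - w) < rad]]))).
  move=> y [+ [q Eq qy]]; rewrite -{}qy ball_normcE normcB => qw.
  have [z0 /= z0Z qz] := Zcov q Eq.
  by exists [` z0Z]%fset => //; exists q.
by apply: covers_bigcup => k; case: (eDP _ (EZ k)) => _ _; exact.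
Qed.

End LocalBound.

Unset Implicit Arguments.
Theorem theorem3p1 (R : realType) (Omega : set R[i]^o)
    (h : R[i]^o -> R[i]^o) (E : set R[i]^o) :
  complex_domain Omega ->
  holomorphic_on Omega h ->
  nonconstant_on Omega h ->
  compact E -> E `<=` Omega ->
  forall theta : R, 0 < theta < 1 ->
    (assouad_spectrum theta (h @` E) <= assouad_spectrum theta E)%E.
Proof.
move=> dO hO nO cE EO theta th01; apply: ereal_inf_le_tmp => _ [alpha [a0 bound] <-].
by exists alpha => //; split=> //; exact: (assouad_bound_image dO hO nO).
Qed.
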